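(* Let $X,U,V$ be Banach spaces, let $A:D(A)\subset X\to X$ generate a $C_0$-semigroup $T=(T(t))_{t\ge 0}$ on $X$, let $B\in L(U,X_{-1})$, $B_2\in L(V,X_{-1})$ and $f:X\times U\to V$. Assume: (a) $B$ is $\infty$-admissible for $T$, and the map $(t,u)\mapsto \Phi(t)u:=\int_0^tT_{-1}(t-s)Bu(s)\,ds$ is continuous from $\mathbb{R}_+\times L^\infty(\mathbb{R}_+,U)$ to $X$; (b) $B_2$ is zero-class $\infty$-admissible for $T$, and for all $u\in L^\infty(\mathbb{R}_+,U)$ and all $x\in C(\mathbb{R}_+,X)$ the map $s\mapsto f(x(s),u(s))$ is in $L^\infty_{loc}(\mathbb{R}_+,V)$; (c) for every $C>0$ there is $L(C)>0$ with $\|f(y,v)-f(x,v)\|_V\le L(C)\|y-x\|_X$ for all $x,y\in X$ with $\|x\|_X,\|y\|_X<C$ and all $v\in U$ with $\|v\|_U<C$; $f(x,\cdot)$ is continuous for every $x\in X$; and there are $\sigma\in\mathcal{K}_\infty$, $c>0$ with $\|f(0,u)\|_V\le\sigma(\|u\|_U)+c$ for all $u\in U$; (d) $f$ is uniformly globally Lipschitz: there is $L>0$ with $\|f(y,v)-f(x,v)\|_V\le L\|y-x\|_X$ for all $x,y\in X$ and all $v\in U$. Then the system $\dot x(t)=Ax(t)+B_2f(x(t),u(t))+Bu(t)$, $x(0)=x_0$, with inputs in $\mathcal{U}:=L^\infty(\mathbb{R}_+,U)$ and flow $\phi$, is forward complete, i.e. $t_m(x,u)=\infty$ for all $(x,u)\in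 X\times\mathcal{U}$, and has bounded reachability sets, i.e. for any $C>0$ and any $\tau>0$ $$\sup\{\|\phi(t,x,u)\|_X:\ \|x\|_X\le C,\ \|u\|_{\mathcal{U}}\le C,\ t\in[0,\tau]\}<\infty.$$
   Context: $\mathcal{K}_\infty$ is the set of continuous, strictly increasing, unbounded $\gamma:\mathbb{R}_+\to\mathbb{R}_+$ with $\gamma(0)=0$. $X_{-1}$ is the completion of $X$ in the norm $x\mapsto\|(aI-A)^{-1}x\|_X$ with some $a\in\rho(A)$; $T$ extends uniquely to a $C_0$-semigroup $T_{-1}=(T_{-1}(t))_{t\ge0}$ on $X_{-1}$. $L^\infty_{loc}(\mathbb{R}_+,Y)$: strongly measurable functions $\mathbb{R}_+\to Y$ that are essentially bounded on every $[0,t]$. An operator $B\in L(U,X_{-1})$ is $\infty$-admissible for $T$ if there is $t>0$ such that $\int_0^tT_{-1}(t-s)Bu(s)\,ds\in X$ for all $u\in L^\infty_{loc}(\mathbb{R}_+,U)$. Equivalently (known fact), for every $t>0$ there is $h_t>0$ such that for all $u\in L^\infty_{loc}(\mathbb{R}_+,U)$ this integral lies in $X$ and has $X$-norm at most $h_t\|u\|_{L^\infty([0,t],U)}$; $t\mapsto h_t$ is assumed (without loss of generality) nondecreasing. $B$ is zero-class $\infty$-admissible if the constants can be chosen with $\lim_{t\to+0}h_t=0$. The same definitions apply to $B_2$ with $V$ in place of $U$. A mild solution on $[0,\tau]$ is a function $x\in C([0,\tau],X)$ such that for all $t\in[0,\tau]$ $$x(t)=T(t)x_0+\int_0^tT_{-1}(t-s)B_2f(x(s),u(s))\,ds+\int_0^tT_{-1}(t-s)Bu(s)\,ds,$$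 with Bochner integrals of $X_{-1}$-valued maps. A function on $[0,t_1)$ is a mild solution if its restriction to $[0,\tau]$ is one for every $\tau\in(0,t_1)$; a mild solution is maximal if it cannot be extended to a mild solution (same $x_0,u$) on a larger interval. Under (a)–(c), for every $x_0\in X$, $u\in\mathcal{U}$ there is a unique maximal mild solution, denoted $\phi(\cdot,x_0,u):[0,t_m(x_0,u))\to X$, $0<t_m(x_0,u)\le\infty$; $\phi$ is called the flow. *)

(* Defs.v *)
From HB Require Import structures.
From mathcomp Require Import all_boot all_order all_algebra.
From mathcomp Require Import all_classical all_reals all_analysis.
From mathcomp Require Import ess_sup_inf.
Import Order.TTheory GRing.Theory Num.Theory.
Import numFieldNormedType.Exports.
Set Implicit Arguments.
Unset Strict Implicit.
Unset Printing Implicit Defensive.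
Local Open Scope classical_set_scope.
Local Open Scope ring_scope.

(** * Bochner integration of Banach space valued functions *)

Section bochner.
Context d (T : measurableType d) (R : realType) (E : normedModType R).
Variables (mu : {measure set T -> \bar R}) (D : set T).
Implicit Types (s f : T -> E) (I : E).

Definition is_simple s :=
  finite_set (range s) /\ forall v, measurable (s @^-1` [set v]).

Definition simple_integrable s :=
  is_simple s /\
  forall v, v != 0 -> (mu (D `&` s @^-1` [set v]) < +oo)%E.

(* [fine] sends an infinite mass to 0; for integrable s this can only affect
   the summand v = 0. *)
Definition simple_integral s : E :=
  \sum_(v \in range s) fine (mu (D `&` s @^-1` [set v])) *: v.

(* The limit is only required almost everywhere, so this is measurability with
   respect to the completion of mu. *)
Definition strongly_measurable f :=
  exists2 s_ : nat -> T -> E, forall n, is_simple (s_ n)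
  & {ae mu, forall x, D x -> s_ n x @[n --> \oo] --> f x}.

(* I is the Bochner integral of f over D. If f is strongly measurable then
   x |-> `|f x - s x| agrees outside a mu-null set with a measurable function.
   The library integral of a nonnegative function is a supremum over the simple
   functions below it, so it does not see null sets. *)
Definition is_bochner_integral f I :=
  strongly_measurable f /\
  exists s_ : nat -> T -> E,
    [/\ forall n, simple_integrable (s_ n),
        (\int[mu]_(x in D) (`|f x - s_ n x|)%:E)%E @[n --> \oo] --> 0%E
      & simple_integral (s_ n) @[n --> \oo] --> I].

Definition Linf_norm f : \bar R :=
  ess_sup mu (fun x => if x \in D then (`|f x|)%:E else 0%E).

End bochner.

(** * Function spaces on the half-line

   Elements of L^oo are represented by functions, not by classes of functions
   modulo equality almost everywhere; values at negative times are irrelevant. *)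

Section function_spaces.
Variable R : realType.

Definition Rplus : set R := `[0, +oo[.

Definition normLinf (Y : normedModType R) (J : set R) (u : R -> Y) : \bar R :=
  Linf_norm (@lebesgue_measure R) J u.

Definition Linf (Y : normedModType R) (u : R -> Y) :=
  strongly_measurable (@lebesgue_measure R) Rplus u /\
  (normLinf Rplus u < +oo)%E.

Definition Linf_loc (Y : normedModType R) (u : R -> Y) :=
  strongly_measurable (@lebesgue_measure R) Rplus u /\
  forall t : R, 0 <= t -> (normLinf `[0%R, t] u < +oo)%E.

Definition K_infinity (g : R -> R) :=
  [/\ {within Rplus, continuous g},
      forall r s, 0 <= r -> r < s -> g r < g s,
      forall M, exists2 r, 0 <= r & M <= g r
    & g 0 = 0].

End function_spaces.
Arguments Rplus {R}.

(** * Semigroups and the extrapolation space *)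

Section semigroups.
Context (R : realType) (X : normedModType R).

Definition C0_semigroup (T : R -> {linear X -> X}) :=
  [/\ forall t, 0 <= t -> continuous (T t),
      forall x, T 0 x = x,
      forall t s x, 0 <= t -> 0 <= s -> T (t + s) x = T t (T s x)
    & forall x, T t x @[t --> 0^'+] --> x].

(* A is only meaningful on its domain DA. *)
Definition generator (T : R -> {linear X -> X}) (DA : set X) (A : X -> X) :=
  DA = [set x | cvg (h^-1 *: (T h x - x) @[h --> 0^'+])] /\
  forall x, DA x -> h^-1 *: (T h x - x) @[h --> 0^'+] --> A x.

(* a is in the resolvent set of A, and Ra = (aI - A)^-1. *)
Definition is_resolvent (DA : set X) (A : X -> X) (a : R)
    (Ra : {linear X -> X}) :=
  [/\ continuous Ra,
      forall x, DA (Ra x) /\ a *: Ra x - A (Ra x) = x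
    & forall x, DA x -> Ra (a *: x - A x) = x].

(* The Banach space E, with the embedding j, is the completion of X for the
   norm x |-> `|Ra x|; this determines (E, j) up to isometric isomorphism. *)
Definition is_extrapolation (Ra : {linear X -> X})
    (E : completeNormedModType R) (j : {linear X -> E}) :=
  (forall x, `|j x| = `|Ra x|) /\ dense (range j).

End semigroups.

(** * Admissibility, mild solutions, the flow

   E plays the role of X_{-1}, T1 that of T_{-1}, and a point of E belongs to X
   when it is in the range of j. *)

Section systems.
Context (R : realType) (X E : normedModType R).
Variables (j : {linear X -> E}) (T1 : R -> {linear E -> E}).

(* I is the integral of T_{-1}(t - s) B u(s) over s in [0, t]. *)
Definition is_convolution (Y : normedModType R) (B : {linear Y -> E})
    (t : R) (u : R -> Y) (I : E) :=
  is_bochner_integral (@lebesgue_measure R) `[0, t]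
    (fun s => T1 (t - s) (B (u s))) I.

Definition admissible (Y : normedModType R) (B : {linear Y -> E}) :=
  exists2 t, 0 < t &
    forall u, Linf_loc u -> exists x, is_convolution B t u (j x).

Definition zero_class_admissible (Y : normedModType R) (B : {linear Y -> E}) :=
  exists h : R -> R,
    [/\ forall t : R, 0 < t -> 0 < h t,
        forall s t : R, 0 < s -> s <= t -> h s <= h t,
        forall (t : R) (u : R -> Y), 0 < t -> Linf_loc u ->
          exists2 x, is_convolution B t u (j x)
                   & (`|x|%:E <= (h t)%:E * normLinf `[0%R, t] u)%E
      & h t @[t --> 0^'+] --> 0].

(* (t, u) |-> Phi(t) u is well defined and continuous from R_+ x L^oo to X. *)
Definition continuous_input_map (Y : normedModType R) (B : {linear Y -> E}) :=
  exists2 Phi : R -> (R -> Y) -> X,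
    forall (t : R) (u : R -> Y), 0 <= t -> Linf u -> is_convolution B t u (j (Phi t u))
  & forall (t : R) (u : R -> Y), 0 <= t -> Linf u -> forall e : R, 0 < e ->
      exists2 delta : R, 0 < delta &
        forall (t' : R) (u' : R -> Y), 0 <= t' -> Linf u' ->
          `|t' - t| < delta -> (normLinf Rplus (u' \- u)%R < delta%:E)%E ->
          `|Phi t' u' - Phi t u| < e.

Context (U V : normedModType R).
Variables (T : R -> {linear X -> X}) (B : {linear U -> E}).
Variables (B2 : {linear V -> E}) (f : X -> U -> V).

Definition mild_solution (x0 : X) (u : R -> U) (tau : R) (x : R -> X) :=
  {within `[0, tau], continuous x} /\
  forall t, 0 <= t <= tau -> exists I2 I : E,
    [/\ is_convolution B2 t (fun s => f (x s) (u s)) I2,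
        is_convolution B t u I
      & j (x t) = j (T t x0) + I2 + I].

(* p = (t1, x) is a mild solution on [0, t1) that does not extend. Every
   larger interval contains some [0, tau] with tau >= t1, hence the form of the
   last condition. *)
Definition maximal_mild_solution (x0 : X) (u : R -> U)
    (p : \bar R * (R -> X)) :=
  [/\ (0 < p.1)%E,
      forall tau : R, 0 < tau -> (tau%:E < p.1)%E -> mild_solution x0 u tau p.2
    & ~ exists (tau : R) (y : R -> X), [/\ (p.1 <= tau%:E)%E, mild_solution x0 u tau y
        & forall t : R, 0 <= t -> (t%:E < p.1)%E -> y t = p.2 t]].

(* The default time 0 is not positive, so t_max x0 u is positive if and only if
   a maximal mild solution exists. *)
Definition the_maximal_mild_solution (x0 : X) (u : R -> U) :
    \bar R * (R -> X) :=
  xget (0%E, cst 0) (maximal_mild_solution x0 u).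

Definition t_max x0 u : \bar R := (the_maximal_mild_solution x0 u).1.

Definition flow (t : R) x0 u : X := (the_maximal_mild_solution x0 u).2 t.

Definition forward_complete :=
  forall x0 u, Linf u -> t_max x0 u = +oo%E.

Definition reachability_norms (C tau : R) : set (\bar R) :=
  [set r | exists (t : R) (x0 : X) (u : R -> U),
     [/\ 0 <= t <= tau, `|x0| <= C, Linf u,
         (normLinf Rplus u <= C%:E)%E & r = `|flow t x0 u|%:E]].

Definition bounded_reachability_sets :=
  forall C tau : R, 0 < C -> 0 < tau ->
    (ereal_sup (reachability_norms C tau) < +oo)%E.

End systems.

(* Main.v *)
Require Import Defs.
From HB Require Import structures.
From mathcomp Require Import all_boot all_order all_algebra finmap.
From mathcomp Require Import all_classical all_reals all_analysis.
From mathcomp Require Import measurable_realfun ess_sup_inf.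
From mathcomp Require Import lra ring.
Import Order.TTheory GRing.Theory Num.Theory.
Import numFieldNormedType.Exports HBNNSimple.
Local Open Scope classical_set_scope.
Local Open Scope ring_scope.

(** Write Z(t) for the integral of T_{-1}(t - s) B_2 v(s) over [0, t]. By
    translation invariance, Z(r + h) = T(h) Z(r) + Z'(h), where Z' belongs to
    the translate v(r + .), so the zero-class estimate on a short interval
    [0, d] propagates: if |v(s)| <= K e^{lam s} then |Z(s)| <= 2 e K e^{lam s},
    where e is the admissibility constant at time d and e^{lam d} = 2 M with
    M >= |T(d)|. For e = 1/(4L) this makes the right-hand side of the mild
    equation a contraction of factor 1/2 in the norm weighted by e^{-lam s}, on
    every interval [0, tau] at once. Picard iteration then yields a global
    solution, and iterating the contraction estimate on the difference of two
    solutions, respectively on a single solution, yields uniqueness and the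
    bound on reachability sets. *)

Set Implicit Arguments.
Unset Strict Implicit.
Unset Printing Implicit Defensive.

(** * Simple functions *)

(** The integrand B_2 v(s) lives only in X_{-1}, so no pointwise norm estimate in X is available
    under the integral sign and Gronwall's lemma cannot be applied; there are only admissibility
    bounds for whole integrals over short intervals. Chaining them over n intervals of length d
    costs M^n, and the weight is tuned to absorb this: in Z(r + d) = T(d) Z(r) + Z'(d) the first
    term is at most M 2 e K e^{lam r} = e K e^{lam (r + d)}, the second at most e K e^{lam (r + d)},
    whence 2 e. For v = f(x, u) - f(y, u) the Lipschitz bound puts L K in place of K, and 2 e L =
    1/2 fixes e. The rate lam is then independent of the interval, the input and the initial value.
    The same propagation bounds Phi(t) u uniformly on bounded sets of inputs: there the short-time
    bound comes from continuity and scaling, and it need not be small. Identities are established in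
    X_{-1} and brought back to X by injectivity of j. *)

Section simple_maps.
Context d (T : measurableType d).

(** Values lie in any [choiceType], so that pairs of simple functions, and pairs with a boolean for
    membership in a set, are simple again. On a normed module this unfolds to the same condition as
    [is_simple]. *)
Definition simple_map (S : choiceType) (p : T -> S) :=
  finite_set (range p) /\ forall w, measurable (p @^-1` [set w]).

Lemma preimage_bigcup_range (S : choiceType) (p : T -> S) (B : set S) :
  p @^-1` B = \bigcup_(w in range p `&` B) p @^-1` [set w].
Proof.
apply/seteqP; split=> [x Bx|x [w [_ Bw] /= pxw]]; last by rewrite /= pxw.
by exists (p x) => //; split => //; exists x.
Qed.

Lemma simple_map_preimage (S : choiceType) (p : T -> S) (B : set S) :
  simple_map p -> measurable (p @^-1` B).
Proof.
move=> [fp mp]; rewrite preimage_bigcup_range.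
by apply: fin_bigcup_measurable => //; exact: finite_setIl.
Qed.

Lemma simple_map_comp (S S' : choiceType) (p : T -> S) (phi : S -> S') :
  simple_map p -> simple_map (phi \o p).
Proof.
move=> sp; split; first by rewrite -(image_comp p phi); apply: finite_image; case: sp.
by move=> w; rewrite comp_preimage; exact: simple_map_preimage.
Qed.

Lemma simple_map_pair (S S' : choiceType) (p : T -> S) (q : T -> S') :
  simple_map p -> simple_map q -> simple_map (fun x => (p x, q x)).
Proof.
move=> [fp mp] [fq mq]; split.
  apply: (sub_finite_set (B := range p `*` range q)); last exact: finite_setX.
  by move=> _ [x _ <-]; split; exists x.
move=> [w w']; have -> : (fun x => (p x, q x)) @^-1` [set (w, w')] =
    p @^-1` [set w] `&` q @^-1` [set w'].
  by apply/seteqP; split=> x /= [] -> ->.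
exact: measurableI.
Qed.

Lemma simple_map_measurable_fun (R : realType) (p : T -> R) (D : set T) :
  simple_map p -> measurable_fun D p.
Proof.
by move=> sp mD B mB; apply: measurableI => //; exact: simple_map_preimage.
Qed.

Lemma simple_map_mem (D : set T) : measurable D -> simple_map (fun x => x \in D).
Proof.
move=> mD; split; first by exact: finite_finset.
case.
  rewrite (_ : _ @^-1` _ = D)//; apply/seteqP; split=> x /=; first exact: set_mem.
  by move=> ?; apply: mem_set.
rewrite (_ : _ @^-1` _ = ~` D); first exact: measurableC.
apply/seteqP; split=> x /=; first by move/negbT; rewrite notin_setE.
by move=> Dx; apply/negbTE; rewrite notin_setE.
Qed.

End simple_maps.

Section change_of_variables.
Context d (T : measurableType d) (R : realType) (E : normedModType R).
Variable mu : {measure set T -> \bar R}.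
Implicit Types (D : set T) (s : T -> E).

(** The fibre of [phi \o p] over [v] is the finite disjoint union of the fibres of [p] over the
    labels sent to [v]; additivity of [mu] and an exchange of two finite sums give the formula. The
    finiteness hypothesis lets [fine] commute with the sum of measures. *)
Lemma simple_integral_compE (S : choiceType) (p : T -> S) (phi : S -> E) D :
  measurable D -> simple_map p ->
  (forall w, phi w != 0 -> (mu (D `&` p @^-1` [set w]) < +oo)%E) ->
  simple_integral mu D (phi \o p) =
  \sum_(w \in range p) fine (mu (D `&` p @^-1` [set w])) *: phi w.
Proof.
move=> mD sp fin_mu; have [fp mp] := sp.
have fpp : finite_set (range (phi \o p)) := proj1 (simple_map_comp phi sp).
have fiber v : fine (mu (D `&` (phi \o p) @^-1` [set v])) *: v =
    \sum_(w \in range p)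
      if w \in phi @^-1` [set v] then fine (mu (D `&` p @^-1` [set w])) *: phi w
      else 0.
  rewrite -fsbig_mkcondr.
  have [->|v0] := eqVneq v 0.
    by rewrite scaler0 fsbig1// => w [_ /= ->]; rewrite scaler0.
  rewrite (_ : _ `&` _ = \bigcup_(w in range p `&` phi @^-1` [set v])
      (D `&` p @^-1` [set w])); last first.
    by rewrite -setI_bigcupr -preimage_bigcup_range comp_preimage.
  have fpv : finite_set (range p `&` phi @^-1` [set v]) by exact: finite_setIl.
  rewrite measure_fin_bigcup//; first last.
  - by move=> w _; exact: measurableI.
  - apply/trivIsetP => w w' _ _ ww'; apply/seteqP; split => // x /= [[_ pw] [_ pw']].
    by move/eqP : ww'; rewrite -pw -pw'; exact.
  rewrite !fsbig_finite//= big_seq [RHS]big_seq -sum_fine ?scaler_suml.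
    by apply: eq_bigr => w; rewrite in_fset_set// => /set_mem[_ /= ->].
  move=> w; rewrite in_fset_set// => /set_mem[_ /= phiw].
  by rewrite ge0_fin_numE// fin_mu// phiw.
rewrite /simple_integral; under eq_fsbigr do rewrite fiber.
rewrite exchange_fsbig//.
apply: eq_fsbigr => w; rewrite inE => -[x _ pxw].
rewrite (fsbigD1 (phi w))//=; last by exists x => //=; rewrite pxw.
rewrite mem_set// fsbig1 ?addr0// => v [_ /= vphi]; rewrite ifN//.
by rewrite notin_setE /= => phiv; exact: vphi.
Qed.

End change_of_variables.

Section simple_integrals.
Context d (T : measurableType d) (R : realType).
Variable mu : {measure set T -> \bar R}.
Implicit Types (D : set T) (E F G : normedModType R).

(** Finiteness on the whole support is easier to transport than finiteness on each fibre: the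
    support of [phi (s x) (s' x)] lies in the union of the two supports. *)
Lemma simple_integrableP E D (s : T -> E) : measurable D ->
  simple_integrable mu D s <->
  simple_map s /\ (mu (D `&` s @^-1` [set~ 0%R]) < +oo)%E.
Proof.
move=> mD; split=> [[ss fin_mu]|[ss fin_mu]]; split => //.
  rewrite preimage_bigcup_range setI_bigcupr.
  have [fs ms] := ss.
  have fs0 : finite_set (range s `&` [set~ 0%R]) by exact: finite_setIl.
  rewrite measure_fin_bigcup//; first last.
  - by move=> w _; exact: measurableI.
  - exact: trivIset_preimage1_in.
  rewrite fsbig_finite//= big_seq; apply: lte_sum_pinfty => w.
  by rewrite in_fset_set// => /set_mem[_ /= /eqP]; exact: fin_mu.
move=> v v0; apply: le_lt_trans fin_mu; apply: le_measure; rewrite ?inE.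
- by apply: measurableI => //; exact: simple_map_preimage.
- by apply: measurableI => //; exact: simple_map_preimage.
by apply: setIS => x /= ->; exact/eqP.
Qed.

Lemma simple_integrable_comp2 E F G D (s : T -> E) (s' : T -> F)
    (phi : E -> F -> G) : measurable D -> phi 0 0 = 0 ->
  simple_integrable mu D s -> simple_integrable mu D s' ->
  simple_integrable mu D (fun x => phi (s x) (s' x)).
Proof.
move=> mD phi0 /(simple_integrableP _ mD)[ss fs] /(simple_integrableP _ mD)[ss' fs'].
apply/(simple_integrableP _ mD); split.
  exact: (simple_map_comp (fun w => phi w.1 w.2) (simple_map_pair ss ss')).
have mI (U : normedModType R) (q : T -> U) B : simple_map q -> measurable (D `&` q @^-1` B).
  by move=> sq; apply: measurableI => //; exact: simple_map_preimage.
apply: le_lt_trans (lte_add_pinfty fs fs').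
apply: (@le_trans _ _ (mu (D `&` s @^-1` [set~ 0%R] `|` D `&` s' @^-1` [set~ 0%R]))); last first.
  by apply: measureU2; exact: mI.
apply: le_measure; rewrite ?inE.
- exact/mI/(simple_map_comp (fun w => phi w.1 w.2) (simple_map_pair ss ss')).
- by apply: measurableU; exact: mI.
move=> x /= [Dx phix]; have [s0|s0] := eqVneq (s x) 0; last by left; split => //; exact/eqP.
right; split => // s'0; apply: phix; rewrite s0 s'0; exact: phi0.
Qed.

Lemma simple_integrable_comp E F D (s : T -> E) (phi : E -> F) :
  measurable D -> phi 0 = 0 ->
  simple_integrable mu D s -> simple_integrable mu D (phi \o s).
Proof.
move=> mD phi0 ss.
by exact: (simple_integrable_comp2 (phi := fun v _ => phi v) mD _ ss ss).
Qed.

(** The pair [p] is a common refinement: the integrals of [s], of [s'] and of any combination become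
    sums over the same labels. *)
Lemma simple_integral_comp2E E F G D (s : T -> E) (s' : T -> F)
    (phi : E -> F -> G) (p := fun x => (s x, s' x)) : measurable D -> phi 0 0 = 0 ->
  simple_integrable mu D s -> simple_integrable mu D s' ->
  simple_integral mu D (fun x => phi (s x) (s' x)) =
  \sum_(w \in range p) fine (mu (D `&` p @^-1` [set w])) *: phi w.1 w.2.
Proof.
move=> mD phi0 /(simple_integrableP _ mD)[ss fs] /(simple_integrableP _ mD)[ss' fs'].
have sp : simple_map p := simple_map_pair ss ss'.
rewrite -(simple_integral_compE (phi := fun w => phi w.1 w.2) mD sp)// => -[w w'] /= phiw.
have mI (U : choiceType) (q : T -> U) B : simple_map q -> measurable (D `&` q @^-1` B).
  by move=> sq; apply: measurableI => //; exact: simple_map_preimage.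
have [w0|w0] := eqVneq w 0; last first.
  apply: le_lt_trans fs; apply: le_measure; rewrite ?inE; try exact: mI.
  by apply: setIS => x /= [-> _]; exact/eqP.
apply: le_lt_trans fs'; apply: le_measure; rewrite ?inE; try exact: mI.
apply: setIS => x /= [_ ->] w'0; move: phiw; rewrite w0 w'0 phi0; exact/negP/negPn/eqP.
Qed.

Lemma simple_integralD E D (s s' : T -> E) : measurable D ->
  simple_integrable mu D s -> simple_integrable mu D s' ->
  simple_integral mu D (fun x => s x + s' x) =
  simple_integral mu D s + simple_integral mu D s'.
Proof.
move=> mD si si'; rewrite (simple_integral_comp2E (phi := fun v w => v + w))// ?addr0//.
rewrite [X in _ = X + _](simple_integral_comp2E (phi := fun v _ => v) mD _ si si')//.
rewrite [X in _ = _ + X](simple_integral_comp2E (phi := fun _ w => w) mD _ si si')//.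
rewrite -fsbig_split//; last by case: (simple_map_pair (proj1 si) (proj1 si')).
by apply: eq_fsbigr => w _; rewrite scalerDr.
Qed.

Lemma simple_integral_linear E F D (s : T -> E) (Q : {linear E -> F}) :
  measurable D -> simple_integrable mu D s ->
  simple_integral mu D (Q \o s) = Q (simple_integral mu D s).
Proof.
move=> mD [ss fin_mu]; rewrite (simple_integral_compE mD ss); last first.
  by move=> w Qw; apply: fin_mu; apply: contraNneq Qw => ->; rewrite linear0.
rewrite /simple_integral !fsbig_finite; [|exact: (proj1 ss)..].
by rewrite linear_sum; apply: eq_bigr => w _; rewrite linearZ.
Qed.

(** The integral of the norm of [s] stands in between: the triangle inequality is applied to the sum
    over the values of [s]. *)
Lemma norm_simple_integral_le E (s : T -> E) (g : T -> \bar R) :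
  simple_integrable mu setT s -> measurable_fun setT g -> (forall x, 0 <= g x)%E ->
  {ae mu, forall x, (`|s x|%:E <= g x)%E} ->
  (`|simple_integral mu setT s|%:E <= \int[mu]_x g x)%E.
Proof.
move=> [ss fin_mu] mg g0 sg; have [fs ms] := ss.
apply: (@le_trans _ _ (\int[mu]_x (`|s x|)%:E)%E); last first.
  apply: ae_ge0_le_integral => //.
    apply/measurable_EFinP.
    apply: simple_map_measurable_fun.
    exact: (simple_map_comp (fun v => `|v|) ss).
  by apply: filterS sg => x.
have normE x : (`|s x|%:E = \sum_(v \in range s) (`|v| * \1_(s @^-1` [set v]) x)%:E)%E.
  rewrite fsumEFin// (fsbigD1 (s x))//=; last by exists x.
  rewrite indicE mem_set//= mulr1 fsbig1 ?addr0// => v [_ vs].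
  by rewrite indicE memNset ?mulr0//= => sv; exact: vs.
under [leRHS]eq_integral do rewrite normE.
rewrite ge0_integral_fsum//; last first.
  by move=> v; apply/measurable_EFinP; apply: measurable_funM => //; exact: measurable_indic.
rewrite /simple_integral !fsbig_finite//=.
have := ler_norm_sum (fset_set (range s))
  (fun v => fine (mu (setT `&` s @^-1` [set v])) *: v) xpredT.
rewrite -lee_fin => /le_trans; apply; rewrite -sumEFin.
apply: lee_sum => v _; under eq_integral do rewrite EFinM.
rewrite ge0_integralZl//; last by apply/measurable_EFinP; exact: measurable_indic.
rewrite integral_indic// normrZ setTI setIT EFinM muleC.
have [->|v0] := eqVneq v 0; first by rewrite normr0 !mul0e.
rewrite lee_wpmul2l// ger0_norm ?fine_ge0// fineK//.
by rewrite ge0_fin_numE//; have := fin_mu v v0; rewrite setTI.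
Qed.

(** Cutting [s] off outside [D] moves integrals between [D] and the whole space. The pair of [s]
    with membership in [D] labels both functions at once. *)
Lemma simple_integral_mem E D (s : T -> E) : measurable D ->
  simple_integrable mu D s ->
  let s' := fun x => if x \in D then s x else 0 in
  simple_integrable mu setT s' /\ simple_integrable mu D s' /\
  simple_integral mu setT s' = simple_integral mu D s /\
  simple_integral mu D s' = simple_integral mu D s.
Proof.
move=> mD si s'; have /(simple_integrableP _ mD)[ss fs] := si.
pose p x := (s x, x \in D).
have sp : simple_map p := simple_map_pair ss (simple_map_mem mD).
have ss' : simple_map s' := simple_map_comp (fun w => if w.2 then w.1 else 0) sp.
have siT : simple_integrable mu setT s'.
  apply/(simple_integrableP _ measurableT); split => //; rewrite setTI.
  rewrite (_ : _ @^-1` _ = D `&` s @^-1` [set~ 0])//.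
  apply/seteqP; split=> x /=; rewrite /s'.
    by case: ifPn => // /set_mem.
  by case=> /mem_set ->.
have finD (B : set T) : (mu B < +oo -> measurable B -> mu (D `&` B) < +oo)%E.
  move=> + mB; apply: le_lt_trans; apply: le_measure; rewrite ?inE//; exact: measurableI.
split => //; split.
  split => // v v0; apply: finD; last exact: (proj2 ss').
  by case: siT => _ /(_ v v0); rewrite setTI.
have finw (w : E * bool) : w.1 != 0 -> (mu (D `&` p @^-1` [set w]) < +oo)%E.
  move=> w0; case: si => _ /(_ w.1 w0); apply: le_lt_trans; apply: le_measure; rewrite ?inE.
  - by apply: measurableI => //; exact: (proj2 sp).
  - by apply: measurableI => //; exact: (proj2 ss).
  by apply: setIS => x /= <-.
have E1 : simple_integral mu D s = \sum_(w \in range p) fine (mu (D `&` p @^-1` [set w])) *: w.1.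
  exact: (simple_integral_compE (phi := fst) mD sp).
have DpE (w : E * bool) : D `&` p @^-1` [set w] = if w.2 then p @^-1` [set w] else set0.
  case: w => w [] /=; apply/seteqP; split=> x //=.
  - by case.
  - by move=> pw; split => //; case: pw => _; exact: set_mem.
  - by move=> [/mem_set Dx [_]]; rewrite Dx.
split.
  rewrite (simple_integral_compE (p := p) (phi := fun w => if w.2 then w.1 else 0) measurableT sp).
    rewrite E1; apply: eq_fsbigr => -[w b] _; rewrite setTI DpE /=.
    by case: b; rewrite // scaler0 measure0 scale0r.
  by move=> [w []] /=; rewrite ?eqxx// setTI => w0; have := finw (w, true) w0; rewrite DpE.
rewrite (simple_integral_compE (p := p) (phi := fun w => if w.2 then w.1 else 0) mD sp).
  rewrite E1; apply: eq_fsbigr => -[w b] _; rewrite DpE /=.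
  by case: b; rewrite // scaler0 measure0 scale0r.
by move=> [w []] /=; rewrite ?eqxx// => w0; exact: (finw (w, true) w0).
Qed.

(** Fibres pull back to fibres of equal measure, and surjectivity of [tau] keeps the range, hence
    the index set of the sum. *)
Lemma simple_integral_pullback E (tau : T -> T) (s : T -> E) :
  measurable_fun setT tau -> set_bij setT setT tau ->
  (forall B, measurable B -> mu (tau @^-1` B) = mu B) ->
  simple_integrable mu setT s ->
  simple_integrable mu setT (s \o tau) /\
  simple_integral mu setT (s \o tau) = simple_integral mu setT s.
Proof.
move=> mtau [_ _ tau_surj] tau_mu [[fs ms] fin_mu].
have range_tau : range (s \o tau) = range s.
  apply/seteqP; split=> _ [x _ <-]; first by exists (tau x).
  by have [y _ <-] := tau_surj x Logic.I; exists y.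
have mu_fiber v : mu (setT `&` (s \o tau) @^-1` [set v]) = mu (setT `&` s @^-1` [set v]).
  by rewrite !setTI comp_preimage tau_mu.
split; last first.
  rewrite /simple_integral range_tau; apply: eq_fsbigr => v _.
  by rewrite mu_fiber.
split; last by move=> v v0; rewrite mu_fiber; exact: fin_mu.
split; first by rewrite range_tau.
by move=> v; rewrite comp_preimage -[X in measurable X]setTI; exact: mtau.
Qed.

End simple_integrals.

(** * Strong measurability and the Bochner integral *)

Section strong_measurability.
Context d (T : measurableType d) (R : realType).
Variable mu : {measure set T -> \bar R}.
Implicit Types (D : set T) (E F G : normedModType R).

Lemma strongly_measurable_ae E D D' (f g : T -> E) :
  {ae mu, forall x, D' x -> D x /\ g x = f x} ->
  strongly_measurable mu D f -> strongly_measurable mu D' g.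
Proof.
move=> fg [s_ ss sf]; exists s_ => //.
by apply: filterS2 fg sf => x + sfx D'x => /(_ D'x)[Dx ->]; exact: sfx.
Qed.

Lemma strongly_measurable_comp2 E F G D (f : T -> E) (g : T -> F) (phi : E -> F -> G) :
  (forall (u : nat -> E) (v : nat -> F) a b, u @ \oo --> a -> v @ \oo --> b ->
     phi (u n) (v n) @[n --> \oo] --> phi a b) ->
  strongly_measurable mu D f -> strongly_measurable mu D g ->
  strongly_measurable mu D (fun x => phi (f x) (g x)).
Proof.
move=> cphi [s_ ss sf] [s'_ ss' sg]; exists (fun n x => phi (s_ n x) (s'_ n x)).
  by move=> n; exact: (simple_map_comp (fun w => phi w.1 w.2) (simple_map_pair (ss n) (ss' n))).
by apply: filterS2 sf sg => x fx gx Dx; apply: cphi; [exact: fx|exact: gx].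
Qed.

Lemma strongly_measurable_mem E D (f : T -> E) : measurable D ->
  strongly_measurable mu D f ->
  strongly_measurable mu setT (fun x => if x \in D then f x else 0).
Proof.
move=> mD [s_ ss sf]; exists (fun n x => if x \in D then s_ n x else 0).
  move=> n; exact: (simple_map_comp (fun w => if w.2 then w.1 else 0)
    (simple_map_pair (ss n) (simple_map_mem mD))).
apply: filterS sf => x fx _; case: ifPn => [/set_mem/fx//|_]; exact: cvg_cst.
Qed.

Lemma ae_pullback (tau : T -> T) (P : T -> Prop) :
  measurable_fun setT tau -> (forall B, measurable B -> mu (tau @^-1` B) = mu B) ->
  {ae mu, forall x, P x} -> {ae mu, forall x, P (tau x)}.
Proof.
move=> mtau tau_mu [N [mN N0 PN]]; exists (tau @^-1` N); split.
- by rewrite -[X in measurable X]setTI; exact: mtau.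
- by rewrite tau_mu.
by move=> x /= Px; apply: PN.
Qed.

Lemma strongly_measurable_pullback E D (tau : T -> T) (f : T -> E) :
  measurable_fun setT tau -> (forall B, measurable B -> mu (tau @^-1` B) = mu B) ->
  strongly_measurable mu D f -> strongly_measurable mu (tau @^-1` D) (f \o tau).
Proof.
move=> mtau tau_mu [s_ ss sf]; exists (fun n => s_ n \o tau).
  move=> n; split.
    apply: sub_finite_set (proj1 (ss n)) => _ [x _ <-]; by exists (tau x).
  move=> v; rewrite comp_preimage -[X in measurable X]setTI; apply: mtau => //.
  by exact: (proj2 (ss n)).
exact: (ae_pullback (P := fun x => D x -> s_ n x @[n --> \oo] --> f x) mtau tau_mu).
Qed.

(* The library integral of a nonnegative function is its lower integral, hence
   no measurability of [F] is needed. *)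
Lemma le_integral_ae_dominated D (F G : T -> \bar R) :
  (forall x, D x -> 0 <= F x)%E ->
  measurable_fun setT G -> (forall x, 0 <= G x)%E ->
  {ae mu, forall x, D x -> (F x <= G x)%E} ->
  (\int[mu]_(x in D) F x <= \int[mu]_x G x)%E.
Proof.
move=> F0 mG G0 FG; rewrite ge0_integralE//; apply: ge_ereal_sup => _ [h /= hF <-].
rewrite -integralT_nnsfun; apply: ae_ge0_le_integral => //.
- by move=> x _; rewrite lee_fin.
- exact/measurable_EFinP/measurable_funP.
apply: filterS FG => x FGx _; apply: le_trans (hF x) _.
by rewrite patchE; case: ifPn => // /set_mem; exact: FGx.
Qed.

(** Every simple function below [G] is below [F \_ D], so the supremum defining the left integral
    runs over fewer functions. *)
Lemma le_integral_patch D (F G : T -> \bar R) :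
  (forall x, D x -> 0 <= F x)%E -> (forall x, 0 <= G x)%E ->
  (forall x, G x <= (F \_ D) x)%E ->
  (\int[mu]_x G x <= \int[mu]_(x in D) F x)%E.
Proof.
move=> F0 G0 GF; rewrite !ge0_integralE//; apply: le_ereal_sup => _ [h /= hF <-].
exists h => // x; apply: le_trans (hF x) _.
by rewrite patch_setT; exact: GF.
Qed.

End strong_measurability.

Section bochner_integrals.
Context d (T : measurableType d) (R : realType).
Variable mu : {measure set T -> \bar R}.
Implicit Types (D : set T) (E F G : normedModType R).

Definition dominating_seq (g_ : nat -> T -> \bar R) :=
  [/\ forall n, measurable_fun setT (g_ n), forall n x, (0 <= g_ n x)%E
    & (\int[mu]_x g_ n x)%E @[n --> \oo] --> 0%E].

(* The majorants [g_] make sums and images of integrands easy to handle: no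
   measurability of [`|f x - s_ n x|] is ever needed. *)
Definition bochner E (f : T -> E) (I : E) :=
  strongly_measurable mu setT f /\
  exists (s_ : nat -> T -> E) (g_ : nat -> T -> \bar R),
    [/\ forall n, simple_integrable mu setT (s_ n), dominating_seq g_,
        forall n, {ae mu, forall x, (`|f x - s_ n x|%:E <= g_ n x)%E}
      & simple_integral mu setT (s_ n) @[n --> \oo] --> I].

Lemma dominating_seqD g_ h_ : dominating_seq g_ -> dominating_seq h_ ->
  dominating_seq (fun n x => g_ n x + h_ n x)%E.
Proof.
move=> [mg g0 cg] [mh h0 ch]; split=> [n|n x|].
- exact: emeasurable_funD.
- exact: adde_ge0.
under eq_fun do rewrite ge0_integralD//.
by have := cvgeD (isT : 0 +? 0)%E cg ch; rewrite adde0; apply.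
Qed.

Lemma dominating_seqZ g_ (k : R) : 0 <= k -> dominating_seq g_ ->
  dominating_seq (fun n x => k%:E * g_ n x)%E.
Proof.
move=> k0 [mg g0 cg]; split=> [n|n x|].
- exact: emeasurable_funM.
- exact: mule_ge0.
under eq_fun do rewrite ge0_integralZl//.
by have := cvgeZl (isT : k%:E \is a fin_num) cg; rewrite mule0; apply.
Qed.

(** The difference [s_ n - s'_ n] of two approximating sequences is dominated by [g_ n + g'_ n],
    whose integral tends to 0. *)
Lemma bochner_unique E (f : T -> E) I I' : bochner f I -> bochner f I' -> I = I'.
Proof.
move=> [_ [s_ [g_ [si dg sg sI]]]] [_ [s'_ [g'_ [si' dg' sg' sI']]]].
have [mh h0 ch] := dominating_seqD dg dg'.
have siB n : simple_integrable mu setT (fun x => s_ n x - s'_ n x).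
  by apply: (simple_integrable_comp2 (phi := fun v w => v - w)); rewrite ?subr0.
have intB n : simple_integral mu setT (fun x => s_ n x - s'_ n x) =
    simple_integral mu setT (s_ n) - simple_integral mu setT (s'_ n).
  rewrite (simple_integralD (s' := fun x => - s'_ n x))//; last first.
    by apply: (simple_integrable_comp (phi := fun v => - v)); rewrite ?oppr0.
  by rewrite -(simple_integral_linear -%R)//.
have le_n n : (`|simple_integral mu setT (s_ n) - simple_integral mu setT (s'_ n)|%:E <=
    \int[mu]_x (g_ n x + g'_ n x))%E.
  rewrite -intB; apply: norm_simple_integral_le => //.
  apply: filterS2 (sg n) (sg' n) => x le1 le2; apply: le_trans (leeD le1 le2).
  rewrite -EFinD lee_fin (_ : s_ n x - s'_ n x = (f x - s'_ n x) - (f x - s_ n x)).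
    by rewrite [leRHS]addrC; exact: ler_normB.
  by rewrite opprB [RHS]addrC addrA subrK.
have lim0 : (`|simple_integral mu setT (s_ n) - simple_integral mu setT (s'_ n)|%:E)
    @[n --> \oo] --> 0%E.
  by apply: squeeze_cvge (cvg_cst 0%E) ch; apply: nearW => n; rewrite le_n andbT lee_fin.
have limI : `|simple_integral mu setT (s_ n) - simple_integral mu setT (s'_ n)|
    @[n --> \oo] --> `|I - I'| by apply: cvg_norm; exact: cvgB.
have : `|I - I'| = 0.
  by rewrite -(cvg_lim _ limI)// -[RHS](cvg_lim _ (fine_cvg lim0)).
by move=> /eqP; rewrite normr_eq0 subr_eq0 => /eqP.
Qed.

Lemma bochner_ae E (f g : T -> E) I :
  {ae mu, forall x, g x = f x} -> bochner f I -> bochner g I.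
Proof.
move=> fg [mf [s_ [g_ [si dg sg sI]]]]; split.
  by apply: strongly_measurable_ae mf; apply: filterS fg.
exists s_, g_; split => // n; by apply: filterS2 fg (sg n) => x ->.
Qed.

Lemma bochnerD E (f g : T -> E) I J :
  bochner f I -> bochner g J -> bochner (fun x => f x + g x) (I + J).
Proof.
move=> [mf [s_ [g_ [si dg sg sI]]]] [mf' [s'_ [g'_ [si' dg' sg' sI']]]]; split.
  by apply: (strongly_measurable_comp2 (phi := fun v w => v + w)) => // *; exact: cvgD.
exists (fun n x => s_ n x + s'_ n x), (fun n x => g_ n x + g'_ n x)%E; split.
- by move=> n; apply: (simple_integrable_comp2 (phi := fun v w => v + w)); rewrite ?addr0.
- exact: dominating_seqD.
- move=> n; apply: filterS2 (sg n) (sg' n) => x le1 le2; apply: le_trans (leeD le1 le2).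
  by rewrite -EFinD lee_fin opprD addrACA; exact: ler_normD.
by under eq_fun do rewrite simple_integralD//; exact: cvgD.
Qed.

Lemma bochner_linear E F (Q : {linear E -> F}) (f : T -> E) I :
  continuous Q -> bochner f I -> bochner (Q \o f) (Q I).
Proof.
move=> cQ [mf [s_ [g_ [si dg sg sI]]]].
have [k k0 Qk] : exists2 k, 0 <= k & forall v, `|Q v| <= k * `|v|.
  have /linear_boundedP/pinfty_ex_gt0[k k0 Qk] := continuous_linear_bounded 0 (cQ 0).
  by exists k => //; exact: ltW.
split.
  apply: (strongly_measurable_comp2 (phi := fun v _ => Q v) _ mf mf) => u _ a _ ua _.
  exact: (cvg_comp _ _ ua (cQ a)).
exists (fun n => Q \o s_ n), (fun n x => k%:E * g_ n x)%E; split.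
- by move=> n; apply: simple_integrable_comp; rewrite ?linear0.
- exact: dominating_seqZ.
- move=> n; apply: filterS (sg n) => x le1 /=; rewrite -linearB.
  by apply: (@le_trans _ _ (k%:E * `|f x - s_ n x|%:E)%E); rewrite ?lee_fin// lee_wpmul2l.
under eq_fun do rewrite simple_integral_linear//.
exact: (cvg_comp _ _ sI (cQ I)).
Qed.

Lemma bochner_pullback E (tau : T -> T) (f : T -> E) I :
  measurable_fun setT tau -> set_bij setT setT tau ->
  (forall B, measurable B -> mu (tau @^-1` B) = mu B) ->
  bochner f I -> bochner (f \o tau) I.
Proof.
move=> mtau btau tau_mu [mf [s_ [g_ [si [mg g0 cg] sg sI]]]]; split.
  have := strongly_measurable_pullback mtau tau_mu mf.
  by apply: strongly_measurable_ae; apply: nearW.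
exists (fun n => s_ n \o tau), (fun n => g_ n \o tau); split.
- by move=> n; case: (simple_integral_pullback mtau btau tau_mu (si n)).
- split=> [n|n x|]; [exact: measurableT_comp|exact: g0|].
  rewrite (_ : (fun n => _) = (fun n => \int[mu]_x g_ n x)%E)//; apply/funext => n.
  transitivity (\int[pushforward mu tau]_x g_ n x)%E.
    by rewrite ge0_integral_pushforward.
  by apply: eq_measure_integral => B mB _; exact: tau_mu.
- move=> n; exact: (ae_pullback (P := fun x => (`|f x - s_ n x|%:E <= g_ n x)%E)).
by under eq_fun do rewrite (proj2 (simple_integral_pullback mtau btau tau_mu (si _))).
Qed.

(** The work is in the majorants: forwards, a measurable one has to be built; backwards, the
    contribution of [s_ n] outside [D] has to be seen to vanish in the limit. *)
Lemma is_bochner_integralP E D (f : T -> E) I : measurable D ->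
  is_bochner_integral mu D f I <->
  bochner (fun x => if x \in D then f x else 0) I.
Proof.
move=> mD; split.
  move=> [mf [s_ [si lim0 sI]]]; have mf' := strongly_measurable_mem mD mf.
  split => //.
  have [sig_ ssig [N [mN N0 sigN]]] := mf.
  have sigf x : D x -> ~ N x -> sig_ n x @[n --> \oo] --> f x.
    by move=> Dx Nx; apply: contrapT => nsig; apply: Nx; apply: sigN => /= /(_ Dx).
  (* On [K] the simple functions [sig_] converge to [f], so the error norm is there a pointwise
     limit of measurable functions. Putting 0 off [K] makes [g n] measurable, and [N] is null. *)
  pose K := D `\` N; have mK : measurable K by exact: measurableD.
  pose g n x : \bar R := if x \in K then `|f x - s_ n x|%:E else 0%E.
  exists (fun n x => if x \in D then s_ n x else 0), g; split.
  - by move=> n; have [] := simple_integral_mem mD (si n).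
  - split=> [n|n x|].
    + pose h k x : R := if x \in K then `|sig_ k x - s_ n x| else 0.
      have mh k : measurable_fun setT (h k).
        apply: simple_map_measurable_fun.
        exact: (simple_map_comp (fun w => if w.2 then `|w.1.1 - w.1.2| else 0)
          (simple_map_pair (simple_map_pair (ssig k) (proj1 (si n))) (simple_map_mem mK))).
      have -> : g n = EFin \o (fun x => if x \in K then `|f x - s_ n x| else 0).
        by apply/funext => x; rewrite /g /=; case: ifP.
      apply/measurable_EFinP; apply: (measurable_fun_cvg mh) => x _; rewrite /h.
      case: ifPn => [/set_mem[Dx Nx]|_]; last exact: cvg_cst.
      by apply: cvg_norm; apply: cvgB; [exact: sigf|exact: cvg_cst].
    + by rewrite /g; case: ifP.
    apply: squeeze_cvge (cvg_cst 0%E) lim0; apply: nearW => n.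
    rewrite integral_ge0/=; last by move=> x _; rewrite /g; case: ifP.
    apply: le_integral_patch => // x.
      by rewrite /g; case: ifP.
    rewrite /g patchE; case: ifPn => [/set_mem[Dx _]|_]; first by rewrite mem_set.
    by case: ifP.
  - move=> n; exists N; split => // x /= nle; apply: contrapT => Nx; apply: nle.
    rewrite /g; case: ifPn => xD; last first.
      by rewrite ifN ?subrr ?normr0//; apply: contraNN xD => /set_mem[Dx _]; rewrite mem_set.
    by rewrite ifT ?mem_set//; split => //; exact: set_mem.
  rewrite (_ : (fun n => _) = (fun n => simple_integral mu D (s_ n)))//.
  by apply/funext => n; have [_ [_ []]] := simple_integral_mem mD (si n).
move=> [mf [s_ [g_ [si [mg g0 cg] sg sI]]]]; split.
  apply: strongly_measurable_ae mf; apply: nearW => x Dx; split => //.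
  by rewrite mem_set.
have siD n : simple_integrable mu D (s_ n).
  case: (si n) => ss fin_mu; split => // v v0.
  apply: le_lt_trans (fin_mu v v0); apply: le_measure; rewrite ?inE//.
  - by apply: measurableI => //; exact: (proj2 ss).
  - by apply: measurableI => //; exact: (proj2 ss).
  exact: setSI.
pose s' n x := if x \in D then s_ n x else 0.
have E' n := simple_integral_mem mD (siD n).
exists s'; split.
- by move=> n; have [_ []] := E' n.
- apply: squeeze_cvge (cvg_cst 0%E) cg; apply: nearW => n.
  rewrite integral_ge0//=.
  apply: le_integral_ae_dominated => //; apply: filterS (sg n) => x.
  by rewrite /s'; case: ifPn => // xD _ Dx; rewrite mem_set in xD.
have siT n : simple_integrable mu setT (s' n) by have [] := E' n.
have siB n : simple_integrable mu setT (fun x => s_ n x - s' n x).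
  by apply: (simple_integrable_comp2 (phi := fun v w => v - w)); rewrite ?subr0.
(* Outside [D] the extended [f] is 0, so [s_ n - s' n] is up to sign the approximation error there,
   and it is 0 on [D]. It is thus dominated by [g_ n], and its integral tends to 0. *)
rewrite (_ : (fun n => _) = (fun n => simple_integral mu setT (s_ n) -
   simple_integral mu setT (fun x => s_ n x - s' n x))); last first.
  apply/funext => n; have [_ [_ [eqT eqD]]] := E' n.
  have sE : s_ n = (fun x => s' n x + (s_ n x - s' n x)).
    by apply/funext => x; rewrite addrC subrK.
  by rewrite [X in _ = simple_integral mu setT X - _]sE simple_integralD// addrK eqD -eqT.
suff sB0 : simple_integral mu setT (fun x => s_ n x - s' n x) @[n --> \oo] --> (0 : E).
  by have := cvgB sI sB0; rewrite subr0; apply.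
suff lim0 : (`|simple_integral mu setT (fun x => s_ n x - s' n x)|%:E)
    @[n --> \oo] --> 0%E by exact: norm_cvg0 (fine_cvg lim0).
apply: squeeze_cvge (cvg_cst 0%E) cg; apply: nearW => n.
rewrite lee_fin normr_ge0/=; apply: norm_simple_integral_le => //.
apply: filterS (sg n) => x; apply: le_trans; rewrite /s' lee_fin.
by case: ifPn; rewrite ?subrr ?normr0 ?normr_ge0// subr0 sub0r normrN.
Qed.

End bochner_integrals.

(** * Translations and convolutions on the half-line *)

Section lebesgue_ae.
Variable R : realType.
Local Notation leb := (@lebesgue_measure R).
Implicit Types P Q S : R -> Prop.

Lemma lebesgue_aeS P Q : (forall s, P s -> Q s) ->
  {ae leb, forall s, P s} -> {ae leb, forall s, Q s}.
Proof. exact: (@filterS _ _ (ae_filter_ringOfSetsType leb)). Qed.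

Lemma lebesgue_aeS2 P Q S : (forall s, P s -> Q s -> S s) ->
  {ae leb, forall s, P s} -> {ae leb, forall s, Q s} -> {ae leb, forall s, S s}.
Proof. exact: (@filterS2 _ _ (ae_filter_ringOfSetsType leb)). Qed.

Lemma lebesgue_aeW P : (forall s, P s) -> {ae leb, forall s, P s}.
Proof. exact: (@nearW _ _ _ (ae_filter_ringOfSetsType leb)). Qed.

End lebesgue_ae.

Section translations.
Variable R : realType.
Local Notation leb := (@lebesgue_measure R).

Lemma measurable_translation (r : R) :
  measurable_fun setT ((fun s => s + r) : measurableTypeR R -> measurableTypeR R).
Proof. exact: measurable_funD. Qed.

Lemma translation_bij (r : R) : set_bij setT setT (fun s : R => s + r).
Proof.
split => // [s s' _ _ /addIr //|s _]; by exists (s - r) => //=; rewrite subrK.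
Qed.

(** The image measure agrees with Lebesgue measure on half-open intervals, which determine it. *)
Lemma lebesgue_measure_translation (r : R) (A : set R) : measurable A ->
  leb ((fun s => s + r) @^-1` A) = leb A.
Proof.
move=> mA; apply/esym.
pose tau := (fun s => s + r) : measurableTypeR R -> measurableTypeR R.
have mtau : measurable_fun setT tau := measurable_translation r.
pose mtau' : {mfun measurableTypeR R >-> measurableTypeR R} :=
  HB.pack tau (isMeasurableFun.Build _ _ _ _ _ mtau).
apply: (lebesgue_measure_unique (mu := pushforward leb mtau')) => //= _ [[a b]] _ <-.
rewrite /pushforward (_ : _ @^-1` _ = [set` `]a - r, b - r]]).
  rewrite !lebesgue_measure_itv/= !lte_fin ltrD2r; case: ifP => //.
  by rewrite -!EFinB => _; congr (_%:E); rewrite opprB addrA subrK.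
by apply/seteqP; split=> s /=; rewrite !in_itv/= ltrBlDr lerBrDr.
Qed.

Lemma ae_translation (r : R) (P : R -> Prop) :
  {ae leb, forall s, P s} -> {ae leb, forall s, P (s + r)}.
Proof.
apply: (@ae_pullback _ _ _ leb (fun s => s + r)); first exact: measurable_translation.
exact: lebesgue_measure_translation.
Qed.

Lemma strongly_measurable_translation (E : normedModType R) (r : R) D (u : R -> E) :
  strongly_measurable leb D u ->
  strongly_measurable leb [set s | D (s + r)] (fun s => u (s + r)).
Proof.
apply: (@strongly_measurable_pullback _ _ _ leb E D (fun s => s + r)).
  exact: measurable_translation.
exact: lebesgue_measure_translation.
Qed.

Lemma bochner_translation (E : normedModType R) (r : R) (u : R -> E) I :
  bochner leb u I -> bochner leb (fun s => u (s + r)) I.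
Proof.
apply: (@bochner_pullback _ _ _ leb E (fun s => s + r)).
- exact: measurable_translation.
- exact: translation_bij.
- exact: lebesgue_measure_translation.
Qed.

End translations.

(** * Essentially bounded functions *)

Section Linf.
Variable R : realType.
Local Notation leb := (@lebesgue_measure R).
Implicit Types (E : normedModType R).

(** The sign of [K] matters because [normLinf] is the essential supremum of a function that is 0 off
    [J]. *)
Lemma normLinf_leP E (J : set R) (u : R -> E) (K : R) : 0 <= K ->
  (normLinf J u <= K%:E)%E <-> {ae leb, forall s, J s -> `|u s| <= K}.
Proof.
move=> K0; split.
  move=> /ess_supP; apply: lebesgue_aeS => s + Js.
  by rewrite mem_set// lee_fin.
move=> uK; apply/ess_supP; apply: lebesgue_aeS uK => s uK.
by case: ifPn => [/set_mem/uK|_]; rewrite lee_fin.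
Qed.

Lemma normLinf_ltyP E (J : set R) (u : R -> E) :
  (normLinf J u < +oo)%E <->
  exists2 K : R, 0 <= K & {ae leb, forall s, J s -> `|u s| <= K}.
Proof.
split; last first.
  by move=> [K K0 /(normLinf_leP _ _ K0)/le_lt_trans]; apply; exact: ltry.
move=> uoo; have [K K0 uK] : exists2 K : R, 0 <= K & (normLinf J u <= K%:E)%E.
  case: (normLinf J u) uoo => [r _|//|_]; last by exists 0 => //; rewrite leNye.
  by exists `|r|; rewrite // lee_fin ler_norm.
by exists K => //; exact/normLinf_leP.
Qed.

Lemma strongly_measurable_Rplus_translation E (u : R -> E) (r : R) : 0 <= r ->
  strongly_measurable leb Rplus u ->
  strongly_measurable leb Rplus (fun s => u (s + r)).
Proof.
move=> r0 /(strongly_measurable_translation r); apply: strongly_measurable_ae.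
apply: lebesgue_aeW => s; rewrite /Rplus /= !in_itv/= !andbT => s0; split => //.
exact: addr_ge0.
Qed.

Lemma Linf_translation E (u : R -> E) (r : R) : 0 <= r ->
  Linf u -> Linf (fun s => u (s + r)).
Proof.
move=> r0 [mu /normLinf_ltyP[K K0 uK]]; split.
  exact: strongly_measurable_Rplus_translation.
apply/normLinf_ltyP; exists K => //.
apply: lebesgue_aeS (ae_translation r uK) => s + s0; apply.
by move: s0; rewrite /Rplus /= !in_itv/= !andbT => s0; exact: addr_ge0.
Qed.

Lemma Linf_loc_translation E (u : R -> E) (r : R) : 0 <= r ->
  Linf_loc u -> Linf_loc (fun s => u (s + r)).
Proof.
move=> r0 [mu uoo]; split; first exact: strongly_measurable_Rplus_translation.
move=> t t0; have /normLinf_ltyP[K K0 uK] := uoo (t + r) (addr_ge0 t0 r0).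
apply/normLinf_ltyP; exists K => //.
apply: lebesgue_aeS (ae_translation r uK) => s + s0; apply.
by move: s0; rewrite /= !in_itv/= lerD2r => /andP[s0 ->]; rewrite addr_ge0.
Qed.

Lemma Linf_locB E (u v : R -> E) : Linf_loc u -> Linf_loc v ->
  Linf_loc (fun s => u s - v s).
Proof.
move=> [mu uoo] [mv voo]; split.
  by apply: (strongly_measurable_comp2 (phi := fun x y => x - y)) => // *; exact: cvgB.
move=> t t0; have /normLinf_ltyP[K K0 uK] := uoo t t0.
have /normLinf_ltyP[L L0 vL] := voo t t0.
apply/normLinf_ltyP; exists (K + L); first exact: addr_ge0.
apply: lebesgue_aeS2 uK vL => s uK vL Js; apply: le_trans (ler_normB _ _) _.
by apply: lerD; [exact: uK|exact: vL].
Qed.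

Lemma LinfZ E (u : R -> E) (k : R) : Linf u -> Linf (fun s => k *: u s).
Proof.
move=> [mu /normLinf_ltyP[K K0 uK]]; split.
  by apply: (strongly_measurable_comp2 (phi := fun x _ => k *: x) _ mu mu) => *; exact: cvgZr.
apply/normLinf_ltyP; exists (`|k| * K); first exact: mulr_ge0.
by apply: lebesgue_aeS uK => s uK Js; rewrite normrZ ler_wpM2l// uK.
Qed.

Lemma Linf_cst0 E : Linf (fun _ : R => 0 : E).
Proof.
split; last by apply/normLinf_ltyP; exists 0 => //; apply: lebesgue_aeW => s _; rewrite normr0.
exists (fun _ _ => 0).
  move=> n; split; first exact: finite_image_cst.
  by move=> v; rewrite preimage_cst; case: ifP.
by apply: lebesgue_aeW => s _; exact: cvg_cst.
Qed.

End Linf.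

Section convolutions.
Context (R : realType) (E : normedModType R) (T1 : R -> {linear E -> E}).
Local Notation leb := (@lebesgue_measure R).

(** Extension by zero puts the integrands for all [t] on the whole line, where they can be
    translated and added. *)
Definition conv_integrand (Y : normedModType R) (B : {linear Y -> E}) (t : R)
  (u : R -> Y) (s : R) : E := if s \in `[0, t]%classic then T1 (t - s) (B (u s)) else 0.

Context (Y : normedModType R) (B : {linear Y -> E}).

Lemma is_convolutionP t u I :
  is_convolution T1 B t u I <-> bochner leb (conv_integrand B t u) I.
Proof. by apply: is_bochner_integralP; exact: measurable_itv. Qed.

Lemma is_convolution_unique t u I I' :
  is_convolution T1 B t u I -> is_convolution T1 B t u I' -> I = I'.
Proof. by move=> /is_convolutionP bI /is_convolutionP; exact: bochner_unique. Qed.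

Lemma eq_is_convolution t u v I : (forall s, 0 <= s <= t -> u s = v s) ->
  is_convolution T1 B t u I -> is_convolution T1 B t v I.
Proof.
move=> uv /is_convolutionP bI; apply/is_convolutionP; apply: bochner_ae bI.
apply: lebesgue_aeW => s; rewrite /conv_integrand; case: ifPn => // /set_mem /=.
by rewrite in_itv/= => /uv ->.
Qed.

Lemma is_convolutionB t u v I J :
  is_convolution T1 B t u I -> is_convolution T1 B t v J ->
  is_convolution T1 B t (fun s => u s - v s) (I - J).
Proof.
move=> /is_convolutionP bI /is_convolutionP bJ; apply/is_convolutionP.
have bN : bochner leb (fun s => - conv_integrand B t v s) (- J).
  by apply: (bochner_linear (Q := -%R)) bJ; exact: opp_continuous.
apply: bochner_ae (bochnerD bI bN); apply: lebesgue_aeW => s; rewrite /conv_integrand.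
by case: ifP => _; rewrite ?subr0// !linearB.
Qed.

Lemma is_convolutionZ t u I (k : R) :
  is_convolution T1 B t u I -> is_convolution T1 B t (fun s => k *: u s) (k *: I).
Proof.
move=> /is_convolutionP bI; apply/is_convolutionP.
have bk : bochner leb (fun s => k *: conv_integrand B t u s) (k *: I).
  by apply: (bochner_linear (Q := *:%R k)) bI; exact: scaler_continuous.
apply: bochner_ae bk; apply: lebesgue_aeW => s; rewrite /conv_integrand.
by case: ifP => _; rewrite ?scaler0// !linearZ.
Qed.

Lemma bochner_cst0 : bochner leb (fun=> 0 : E) 0.
Proof.
have is0 : is_simple (fun _ : measurableTypeR R => 0 : E).
  split; first exact: finite_image_cst.
  by move=> v; rewrite preimage_cst; case: ifP.
split.
  by exists (fun _ _ => 0) => //; apply: lebesgue_aeW => s _; exact: cvg_cst.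
exists (fun _ _ => 0), (fun _ _ => 0%E); split.
- move=> _; split => // v v0; rewrite preimage_cst ifN ?setI0 ?measure0//.
  by rewrite notin_setE /= => v0'; move: v0; rewrite -v0' eqxx.
- split => //; rewrite integral0; exact: cvg_cst.
- by move=> _; apply: lebesgue_aeW => s; rewrite subrr normr0.
rewrite /simple_integral fsbig1; first exact: cvg_cst.
by move=> v [_ _ <-]; rewrite scaler0.
Qed.

Lemma is_convolution0 u : is_convolution T1 B 0 u 0.
Proof.
apply/is_convolutionP; apply: bochner_ae bochner_cst0.
exists [set 0]; split; [exact: measurable_set1|exact: lebesgue_measure_set1|].
move=> s /=; rewrite /conv_integrand; case: ifPn => // /set_mem /= + _.
by rewrite in_itv/= -eq_le => /eqP.
Qed.

(** For [s <= r] the semigroup law factors [T1 (r + h - s)] as [T1 h] after [T1 (r - s)]; for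
    [s >= r] the integrand is that of the translate, moved by [r]. *)
Lemma is_convolution_split (r h : R) u I I' :
  (forall t : R, 0 <= t -> continuous (T1 t)) ->
  (forall (t s : R) x, 0 <= t -> 0 <= s -> T1 (t + s) x = T1 t (T1 s x)) ->
  0 <= r -> 0 <= h ->
  is_convolution T1 B r u I -> is_convolution T1 B h (fun s => u (s + r)) I' ->
  is_convolution T1 B (r + h) u (T1 h I + I').
Proof.
move=> cT1 T1D r0 h0 /is_convolutionP bI /is_convolutionP bI'; apply/is_convolutionP.
have b1 := bochner_linear (cT1 h h0) bI.
have b2 := bochner_translation (- r) bI'.
apply: bochner_ae (bochnerD b1 b2).
(* Both pieces count the common endpoint [r], a null set. *)
exists [set r]; split; [exact: measurable_set1|exact: lebesgue_measure_set1|].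
move=> s /= neq; apply: contrapT => /eqP sr; apply: neq.
rewrite /conv_integrand !mem_setE !in_itv/= lerBlDr subr_ge0 [h + r]addrC.
have [s0|s0] := boolP (0 <= s); last first.
  have /negbTE rs : ~~ (r <= s) by apply: contra s0; exact: le_trans.
  by rewrite rs /= linear0 addr0.
have [rs|rs] := leP r s.
  have /negbTE -> : ~~ (s <= r) by rewrite -ltNge lt_neqAle eq_sym sr.
  by rewrite /= linear0 add0r subrK; case: ifP => // _; congr (T1 _ _); lra.
rewrite (ltW rs) /= addr0 ifT; last lra.
by rewrite -T1D//; [congr (T1 _ _); lra|lra].
Qed.

End convolutions.

(** * Semigroups *)

Section elementary.
Variable R : realType.

Lemma within_continuousP (X : normedModType R) (D : set R) (x : R -> X) :
  {within D, continuous x} <->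
  forall t e : R, D t -> 0 < e -> exists2 d : R, 0 < d &
    forall s, D s -> `|s - t| < d -> `|x s - x t| < e.
Proof.
split=> [/subspace_continuousP cx t e Dt e0|cx].
  have /cvgrPdist_lt/(_ e e0) := cx t Dt.
  rewrite near_withinE => /nbhs_normP[d /= d0 dP]; exists d => // s Ds sd.
  by rewrite distrC; apply: dP => //=; rewrite distrC.
apply/subspace_continuousP => t Dt; apply/cvgrPdist_lt => e e0.
rewrite near_withinE; have [d d0 dP] := cx t e Dt e0.
apply/nbhs_normP; exists d => //= s /= sd Ds.
by rewrite distrC; apply: dP => //; rewrite distrC.
Qed.

Lemma bounded_on_segment (X : normedModType R) (tau : R) (x : R -> X) : 0 <= tau ->
  {within `[0, tau], continuous x} ->
  exists2 K : R, 0 <= K & forall s, 0 <= s <= tau -> `|x s| <= K.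
Proof.
move=> tau0 /within_continuousP cx.
have /(EVT_max tau0)[c _ cmax] : {within `[0, tau], continuous (fun s => `|x s|)}.
  apply/within_continuousP => t e Dt e0; have [d d0 dP] := cx t e Dt e0.
  exists d => // s Ds sd; apply: le_lt_trans (dP s Ds sd).
  exact: ler_dist_dist.
by exists `|x c|.
Qed.

(** Closes the iterations of the contraction: the initial error [k] is halved at each step while [b]
    stays. *)
Lemma le_of_halving (a b k : R) : 0 <= k ->
  (forall n, a <= k / 2 ^+ n + b) -> a <= b.
Proof.
move=> k0 akb; rewrite leNgt; apply/negP => ba.
have ab0 : 0 < a - b by rewrite subr_gt0.
have [n kn] : exists n : nat, k / (a - b) < n%:R.
  by exists (Num.truncn (k / (a - b))).+1; exact: truncnS_gt.
have n2 : n%:R <= (2 : R) ^+ n.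
  by rewrite -natrX ler_nat; apply/ltnW/ltn_expl.
have := akb n; rewrite leNgt => /negP; apply.
rewrite -ltrBrDr ltr_pdivrMr ?exprn_gt0//.
by rewrite mulrC -ltr_pdivrMr//; exact: lt_le_trans n2.
Qed.

End elementary.

Section semigroup.
Context (R : realType) (X : completeNormedModType R) (T : R -> {linear X -> X}).
Hypothesis hT : C0_semigroup T.

Let T_cont t : 0 <= t -> continuous (T t). Proof. by case: hT => cT _ _ _; exact: cT. Qed.
Let T0 x : T 0 x = x. Proof. by case: hT => _ T0 _ _; exact: T0. Qed.
Let TD t s x : 0 <= t -> 0 <= s -> T (t + s) x = T t (T s x).
Proof. by case: hT => _ _ TD _; exact: TD. Qed.

Lemma semigroup_near0 x e : 0 < e ->
  exists2 d : R, 0 < d & forall t, 0 <= t -> t < d -> `|T t x - x| < e.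
Proof.
case: hT => _ _ _ /(_ x)/cvgrPdist_lt + e0 => /(_ e e0).
rewrite /at_right near_withinE => /nbhs_normP[d /= d0 dP]; exists d => // t.
rewrite le_eqVlt => /orP[/eqP<- _|t0 td]; first by rewrite T0 subrr normr0.
by rewrite distrC; apply: dP => //=; rewrite sub0r normrN gtr0_norm.
Qed.

Lemma semigroup_op_bounded t : 0 <= t ->
  exists2 M : R, 1 <= M & forall x, `|T t x| <= M * `|x|.
Proof.
move=> t0.
have /linear_boundedP/pinfty_ex_gt0[M M0 TM] := continuous_linear_bounded 0 (@T_cont t t0 0).
exists (Num.max M 1) => [|x]; first by rewrite le_max lexx orbT.
by apply: le_trans (TM x) _; rewrite ler_wpM2r// le_max lexx.
Qed.

(** Otherwise there are times at most [1 / (n + 1)] where the operator norm exceeds [n + 1]. Strong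
    continuity at 0 makes these operators pointwise bounded, and Banach-Steinhaus gives a
    contradiction. *)
Lemma semigroup_bounded_near0 : exists d M : R, [/\ 0 < d, 1 <= M &
  forall t x, 0 <= t <= d -> `|T t x| <= M * `|x|].
Proof.
apply: contrapT => noM.
have /choice[p pP] (n : nat) : exists q : R * X,
    [/\ 0 <= q.1, q.1 <= n.+1%:R^-1 & n.+1%:R * `|q.2| < `|T q.1 q.2|].
  apply: contrapT => noq; apply: noM; exists n.+1%:R^-1, n.+1%:R.
  split; [by rewrite invr_gt0|by rewrite ler1n|move=> t x /andP[t0 tn]].
  by rewrite leNgt; apply/negP => ltT; apply: noq; exists (t, x).
pose F := [set g : X -> X | exists n, g = T (p n).1].
have [f [n ->]|x|M FM] := @Banach_Steinhauss R X X F _ _ 1.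
- split; last by move=> c u v; rewrite linearP.
  have [t0 _ _] := pP n; have [M M1 TM] := semigroup_op_bounded t0.
  move=> r; exists (M * r) => x xr; apply: le_trans (TM x) _.
  by rewrite ler_wpM2l// (le_trans ler01).
- have [d d0 dP] := semigroup_near0 x ltr01.
  (* From [N] on, the times are below [d] and the orbit is within 1 of [x]; the sum covers the
     finitely many earlier indices. *)
  pose N := (Num.truncn d^-1).+1.
  exists (`|x| + 1 + \sum_(k < N) `|T (p k).1 x|) => _ [n ->].
  have [nN|Nn] := ltnP n N.
    rewrite (bigD1 (Ordinal nN))//= addrCA ler_wpDr// !addr_ge0//.
    by apply: sumr_ge0.
  rewrite ler_wpDr ?sumr_ge0// -lerBlDl.
  apply: le_trans (lerB_dist _ _) _; apply/ltW/dP; first by case: (pP n).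
  have [_ pn _] := pP n; apply: le_lt_trans pn _.
  rewrite -[ltRHS]invrK ltf_pV2 ?posrE ?invr_gt0// (lt_le_trans (truncnS_gt _))//.
  by rewrite ler_nat ltnW.
(* Since [n + 1 > M], the choice of [p n] violates the uniform bound [M]. *)
pose n := Num.truncn M.
have Fn : F (T (p n).1) by exists n.
have := pP n; case: (p n) (FM _ Fn) => t x /= {}FM [t0 tn]; apply/negP; rewrite -leNgt.
have [->|x0] := eqVneq x 0; first by rewrite linear0 normr0 mulr0.
have nx : 0 < `|x| by rewrite normr_gt0.
have : `|T t (`|x|^-1 *: x)| <= M.
  by apply: FM; rewrite normrZ normfV normr_id mulVf// gt_eqF.
rewrite linearZ normrZ normfV normr_id ler_pdivrMl// mulrC => /le_trans; apply.
by rewrite ler_wpM2r//; apply/ltW/truncnS_gt.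
Qed.

(** A time of at most [n * d] costs a factor [M ^+ n]. *)
Lemma semigroup_bounded tau : exists2 M : R, 1 <= M &
  forall t x, 0 <= t <= tau -> `|T t x| <= M * `|x|.
Proof.
have [d [M [d0 M1 TM]]] := semigroup_bounded_near0.
have M0 : 0 <= M := le_trans ler01 M1.
have TMn n t x : 0 <= t <= n%:R * d -> `|T t x| <= M ^+ n * `|x|.
  elim: n t x => [|n IHn] t x /andP[t0]; first rewrite mul0r => t0'.
    by rewrite (_ : t = 0) ?T0 ?expr0 ?mul1r//; apply/eqP; rewrite eq_le t0 t0'.
  move=> tn; have [td|dt] := leP t d.
    apply: le_trans (TM t x _) _; first by rewrite t0.
    by rewrite ler_wpM2r// exprS ler_peMr// exprn_ege1.
  rewrite -(subrKC d t) TD ?subr_ge0 ?(ltW d0) ?(ltW dt)//.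
  apply: le_trans (TM _ _ _) _; first by rewrite (ltW d0) lexx.
  rewrite exprS -mulrA ler_wpM2l// IHn// subr_ge0 (ltW dt)/=.
  by move: tn; rewrite -natr1 mulrDl mul1r lerBlDr.
pose n := (Num.truncn (tau / d)).+1; exists (M ^+ n); first exact: exprn_ege1.
move=> t x /andP[t0 ttau]; apply: TMn; rewrite t0/=; apply: le_trans ttau _.
by rewrite -ler_pdivrMr//; apply/ltW/truncnS_gt.
Qed.

(** The earlier of the two times always serves as base point, so a single estimate, with [T] bounded
    up to [t + 1], gives continuity from both sides. *)
Lemma semigroup_continuous x t e : 0 <= t -> 0 < e -> exists2 d : R, 0 < d &
  forall s, 0 <= s -> `|s - t| < d -> `|T s x - T t x| < e.
Proof.
move=> t0 e0; have [M M1 TM] := semigroup_bounded (t + 1).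
have M0 : 0 < M := lt_le_trans ltr01 M1.
have [d d0 dP] := semigroup_near0 x (divr_gt0 e0 M0).
have step r h : 0 <= r <= t + 1 -> 0 <= h -> h < d -> `|T (r + h) x - T r x| < e.
  move=> /andP[r0 rt] h0 hd; rewrite TD// -linearB.
  apply: le_lt_trans (TM _ _ _) _; first by rewrite r0.
  by rewrite mulrC -ltr_pdivlMr//; exact: dP.
exists (Num.min d 1) => [|s s0]; first by rewrite lt_min d0 ltr01.
rewrite lt_min => /andP[sd s1]; have [ts|st] := leP t s.
  rewrite ger0_norm ?subr_ge0// in sd s1.
  by rewrite -{1}(subrKC t s); apply: step; rewrite ?t0 ?subr_ge0//= lerDl.
rewrite ltr0_norm ?subr_lt0// opprB in sd s1.
rewrite distrC -{1}(subrKC s t); apply: step; rewrite ?s0 ?subr_ge0 ?(ltW st)//=.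
by apply: le_trans (ltW st) _; rewrite lerDl.
Qed.

End semigroup.

Section extrapolation.
Context (R : realType) (X : normedModType R) (E : completeNormedModType R).

(** If [j x = j y] then [Ra (x - y) = 0], and the resolvent identity at [x - y] gives [x - y = 0].
    As [A] is a bare function, [A 0 = 0] is read off from the difference quotients. *)
Lemma extrapolation_inj (T : R -> {linear X -> X}) DA A a (Ra : {linear X -> X})
    (j : {linear X -> E}) :
  generator T DA A -> is_resolvent DA A a Ra -> is_extrapolation Ra j -> injective j.
Proof.
move=> [_ hA] [_ RaP _] [jRa _].
have A0 : DA 0 -> A 0 = 0.
  move=> /hA; rewrite (_ : (fun h => _) = cst 0); last first.
    by apply/funext => h; rewrite linear0 subrr scaler0.
  by move=> /(cvg_lim (@norm_hausdorff _ _)) <-; rewrite lim_cst.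
move=> x y jxy; apply/eqP; rewrite -subr_eq0.
have Rxy : Ra (x - y) = 0.
  by apply/eqP; rewrite -normr_eq0 -jRa linearB jxy subrr normr0.
by have [] := RaP (x - y); rewrite Rxy => /A0 ->; rewrite scaler0 subrr => <-.
Qed.

End extrapolation.

(** * Convolutions with values in X *)

Section convolutions_in_X.
Context (R : realType) (X E : completeNormedModType R).
Context (T : R -> {linear X -> X}) (T1 : R -> {linear E -> E}) (j : {linear X -> E}).
Hypotheses (hT : C0_semigroup T) (hT1 : C0_semigroup T1).
Hypothesis T1j : forall t x, 0 <= t -> T1 t (j x) = j (T t x).
Hypothesis j_inj : injective j.
Local Notation leb := (@lebesgue_measure R).

Lemma is_convolution_splitX (Y : normedModType R) (B : {linear Y -> E}) (r h : R) u x x' :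
  0 <= r -> 0 <= h -> is_convolution T1 B r u (j x) ->
  is_convolution T1 B h (fun s => u (s + r)) (j x') ->
  is_convolution T1 B (r + h) u (j (T h x + x')).
Proof.
move=> r0 h0 cx cx'; rewrite linearD -T1j//.
by case: hT1 => cT1 _ T1D _; exact: is_convolution_split.
Qed.

Lemma is_convolutionX_unique (Y : normedModType R) (B : {linear Y -> E}) t u x x' :
  is_convolution T1 B t u (j x) -> is_convolution T1 B t u (j x') -> x = x'.
Proof. by move=> cx cx'; apply: j_inj; exact: is_convolution_unique cx cx'. Qed.

(* The weight [expR (lam * s)] gains a factor [2 * M] over a time [d], which
   absorbs the growth [M] of [T d]. *)
Lemma convolution_growth (Y : normedModType R) (B : {linear Y -> E}) (d : R) :
  0 < d -> exists2 lam : R, 0 <= lam & forall (u : R -> Y) (Z : R -> X) (tau k : R),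
    (forall s, 0 <= s <= tau -> is_convolution T1 B s u (j (Z s))) ->
    (forall r h, 0 <= r -> 0 <= h <= d -> r + h <= tau ->
       exists2 z, is_convolution T1 B h (fun s => u (s + r)) (j z)
                & `|z| <= k * expR (lam * (r + h))) ->
    forall s, 0 <= s <= tau -> `|Z s| <= 2 * k * expR (lam * s).
Proof.
move=> d0; have [M M1 TM] := semigroup_op_bounded hT (ltW d0).
have M0 : 0 < M := lt_le_trans ltr01 M1.
have M2 : 1 <= 2 * M by lra.
exists (ln (2 * M) / d) => [|u Z tau k cZ cz].
  by rewrite divr_ge0 ?ln_ge0// ltW.
set lam := ln (2 * M) / d.
have lamd : expR (lam * d) = 2 * M.
  by rewrite /lam divfK ?gt_eqF// lnK// posrE mulr_gt0.
have Zn n s : 0 <= s <= tau -> s < n%:R * d -> `|Z s| <= 2 * k * expR (lam * s).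
  elim: n s => [|n IHn] s /andP[s0 stau] sn; first by move: sn; rewrite mul0r ltNge s0.
  have [sd|ds] := leP s d.
    (* On the initial interval the local bound with [r = 0] suffices; passing from [k] to [2 * k]
       needs [0 <= k], which that bound itself implies. *)
    have [|||z cz0] := cz 0 s; rewrite ?add0r ?s0//.
    rewrite (is_convolutionX_unique (cZ s _) (x' := z)) ?s0//; last first.
      by apply: eq_is_convolution cz0 => r _; rewrite addr0.
    move=> zk; apply: (le_trans zk); rewrite ler_wpM2r ?expR_ge0//.
    have : 0 <= k * expR (lam * s) := le_trans (normr_ge0 _) zk.
    by rewrite pmulr_lge0 ?expR_gt0// => k0; lra.
  have sd0 : 0 <= s - d by rewrite subr_ge0 ltW.
  have [|||z cz0] := cz (s - d) d; rewrite ?subrK ?(ltW d0) ?lexx//.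
  move=> zk.
  have sdtau : 0 <= s - d <= tau by rewrite sd0 (le_trans _ stau)// gerBl ltW.
  have cZs := is_convolution_splitX sd0 (ltW d0) (cZ _ sdtau) cz0.
  rewrite subrK in cZs.
  rewrite (is_convolutionX_unique (cZ s _) cZs) ?s0//.
  apply: (le_trans (ler_normD _ _)).
  have IH : `|Z (s - d)| <= 2 * k * expR (lam * (s - d)).
    by apply: IHn => //; move: sn; rewrite -natr1 mulrDl mul1r ltrBlDr.
  have {}IH : `|T d (Z (s - d))| <= M * (2 * k * expR (lam * (s - d))).
    by apply: (le_trans (TM _)); rewrite ler_wpM2l// ltW.
  have es : expR (lam * s) = 2 * M * expR (lam * (s - d)).
    by rewrite -lamd -expRD -mulrDr subrKC.
  apply: le_trans (lerD IH zk) _; rewrite es; lra.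
move=> s s0tau; apply: (Zn (Num.truncn (s / d)).+1) => //.
by rewrite -ltr_pdivrMr//; exact: truncnS_gt.
Qed.

(** * Zero-class admissible operators *)

Section zero_class.
Context (V : normedModType R) (B2 : {linear V -> E}).
Hypothesis hB2 : zero_class_admissible j T1 B2.

Lemma zero_class_convolution t v : 0 <= t -> Linf_loc v ->
  exists x, is_convolution T1 B2 t v (j x).
Proof.
rewrite le_eqVlt => /orP[/eqP<- _|t0 lv].
  by exists 0; rewrite linear0; exact: is_convolution0.
by case: hB2 => h [_ _ /(_ t v t0 lv)[x cx _] _]; exists x.
Qed.

(** Turns the limit of the admissibility constants into a prescribed constant [e]. Time 0 is treated
    apart, those constants being given for positive times. *)
Lemma zero_class_small (e : R) : 0 < e -> exists2 d : R, 0 < d &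
  forall t v z (K : R), 0 <= t <= d -> Linf_loc v -> is_convolution T1 B2 t v (j z) ->
    0 <= K -> {ae leb, forall s, 0 <= s <= t -> `|v s| <= K} -> `|z| <= e * K.
Proof.
case: hB2 => h [h0 hmono hz hlim] e0.
move/cvgrPdist_lt : hlim => /(_ e e0); rewrite /at_right near_withinE.
(* Half the radius, because the endpoint of the time range is to be included. *)
move=> /nbhs_normP[d /= d0 dP]; exists (d / 2); first by rewrite divr_gt0.
move=> t v z K /andP[+ td] lv cz K0 vK.
rewrite le_eqVlt => /orP[/eqP t0|t0].
  move: cz; rewrite -t0 => /is_convolution_unique/(_ (is_convolution0 T1 B2 v)).
  rewrite -[0 in RHS](linear0 j) => /j_inj ->; rewrite normr0.
  by rewrite mulr_ge0// ltW.
have [x cx xh] := hz t v t0 lv; rewrite (is_convolutionX_unique cz cx).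
have hte : h t < e.
  have td' : t < d by lra.
  have := dP t; rewrite /= sub0r normrN gtr0_norm// => /(_ td' t0).
  by rewrite sub0r normrN gtr0_norm// h0.
rewrite -lee_fin; apply: (le_trans xh); rewrite EFinM.
apply: (@le_trans _ _ ((h t)%:E * K%:E)%E).
  rewrite lee_wpmul2l ?lee_fin ?(ltW (h0 _ _))//; apply/normLinf_leP => //.
by rewrite lee_wpmul2r ?lee_fin// ltW.
Qed.

(** Over a window from [r] to [r + h] the translate of [v] is at most [K * expR (lam * (r + h))], so
    [convolution_growth] applies with [k = e * K]. *)
Lemma zero_class_growth (e : R) : 0 < e -> exists2 lam : R, 0 <= lam &
  forall (v : R -> V) (Z : R -> X) (tau K : R), Linf_loc v ->
    (forall s, 0 <= s <= tau -> is_convolution T1 B2 s v (j (Z s))) -> 0 <= K ->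
    {ae leb, forall s, 0 <= s <= tau -> `|v s| <= K * expR (lam * s)} ->
    forall s, 0 <= s <= tau -> `|Z s| <= 2 * e * K * expR (lam * s).
Proof.
move=> e0; have [d d0 zd] := zero_class_small e0.
have [lam lam0 growth] := convolution_growth B2 d0; exists lam => // v Z tau K lv cZ K0 vK.
rewrite -(mulrA 2); apply: growth (cZ) _ => r h r0 /andP[h0 hd] rh.
have lvr := Linf_loc_translation r0 lv.
have [z cz] := zero_class_convolution h0 lvr; exists z => //.
rewrite -mulrA; apply: zd lvr cz _ _ => //; first by rewrite h0.
  by rewrite mulr_ge0// expR_ge0.
apply: lebesgue_aeS (ae_translation r vK) => s + /andP[s0 sh].
have srtau : 0 <= s + r <= tau by lra.
move=> /(_ srtau)/le_trans; apply; rewrite ler_wpM2l// ler_expR ler_wpM2l//; lra.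
Qed.

(** From a base point [r <= t] close to [t], [Z s] is the orbit value [T (s - r) (Z r)] up to an
    integral over a short window, which is small. Continuity of the orbit then handles both sides of
    [t] at once. *)
Lemma zero_class_continuous v (Z : R -> X) : Linf_loc v ->
  (forall s, 0 <= s -> is_convolution T1 B2 s v (j (Z s))) ->
  {within Rplus, continuous Z}.
Proof.
move=> lv cZ; apply/within_continuousP => t e; rewrite /Rplus /= in_itv/= andbT => t0 e0.
have /normLinf_ltyP[K K0 vK] := proj2 lv (t + 1) (addr_ge0 t0 ler01).
have K1 : 0 < K + 1 by lra.
(* The budget is [e / 4] for each of [s] and [t] and [e / 2] for the orbit; [K + 1] keeps the
   divisor positive. *)
have e40 : 0 < e / 4 / (K + 1) by rewrite !divr_gt0.
have [d1 d10 zd] := zero_class_small e40.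
pose d := Num.min d1 1; have d0 : 0 < d by rewrite lt_min d10 ltr01.
have [dd1 dle1] : d <= d1 /\ d <= 1 by rewrite !ge_min !lexx orbT.
pose r := Num.max 0 (t - d / 2).
have r0 : 0 <= r by rewrite le_max lexx.
have rt : r <= t by rewrite ge_max t0 gerBl divr_ge0// ltW.
have tr : t - d / 2 <= r by rewrite le_max lexx orbT.
have step s : r <= s -> s <= t + d / 2 -> `|Z s - T (s - r) (Z r)| <= e / 4.
  move=> rs st; have h0 : 0 <= s - r by rewrite subr_ge0.
  have lvr := Linf_loc_translation r0 lv.
  have [z cz] := zero_class_convolution h0 lvr.
  have cs := is_convolution_splitX r0 h0 (cZ r r0) cz.
  rewrite subrKC in cs.
  rewrite (is_convolutionX_unique (cZ s (le_trans r0 rs)) cs) addrC addKr.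
  apply: (@le_trans _ _ (e / 4 / (K + 1) * (K + 1))); last by rewrite divfK// gt_eqF.
  apply: (zd _ _ _ _ _ lvr cz (ltW K1)); first by rewrite h0/=; lra.
  apply: lebesgue_aeS (ae_translation r vK) => q + /andP[q0 qs].
  have qr : `[0, t + 1]%classic (q + r) by rewrite /= in_itv/=; apply/andP; split; lra.
  by move=> /(_ qr)/le_trans; apply; lra.
have tr0 : 0 <= t - r by rewrite subr_ge0.
have e20 : 0 < e / 2 by lra.
have [d2 d20 Td] := semigroup_continuous hT (Z r) tr0 e20.
exists (Num.min d2 (d / 2)) => [|s]; first by rewrite lt_min d20 divr_gt0.
rewrite /= in_itv/= andbT => s0; rewrite lt_min => /andP[sd2].
rewrite ltr_norml => /andP[sd sd'].
have rs : r <= s by rewrite ge_max s0/=; lra.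
have sd3 : s <= t + d / 2 by lra.
have Zs := step s rs sd3.
have td : t <= t + d / 2 by lra.
have Zt := step t rt td.
have Tst : `|T (s - r) (Z r) - T (t - r) (Z r)| < e / 2.
  by apply: Td; rewrite ?subr_ge0// (_ : s - r - (t - r) = s - t)//; lra.
rewrite (_ : Z s - Z t = (Z s - T (s - r) (Z r)) + (T (s - r) (Z r) - T (t - r) (Z r))
  - (Z t - T (t - r) (Z r))); last by rewrite opprB !addrA !subrK.
apply: le_lt_trans (ler_normB _ _) _.
have := ler_normD (Z s - T (s - r) (Z r)) (T (s - r) (Z r) - T (t - r) (Z r)).
lra.
Qed.

End zero_class.

(** * The input map *)

Section input_map.
Context (U : normedModType R) (B : {linear U -> E}) (Phi : R -> (R -> U) -> X).
Hypothesis Phi_conv : forall (t : R) u, 0 <= t -> Linf u ->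
  is_convolution T1 B t u (j (Phi t u)).
Hypothesis Phi_cont : forall (t : R) (u : R -> U), 0 <= t -> Linf u -> forall e : R, 0 < e ->
  exists2 delta : R, 0 < delta &
    forall (t' : R) (u' : R -> U), 0 <= t' -> Linf u' ->
      `|t' - t| < delta -> (normLinf Rplus (u' \- u)%R < delta%:E)%E ->
      `|Phi t' u' - Phi t u| < e.

Lemma input_map_continuous u : Linf u -> {within Rplus, continuous (Phi^~ u)}.
Proof.
move=> lu; apply/within_continuousP => t e; rewrite /Rplus /= in_itv/= andbT => t0 e0.
have [d d0 dP] := Phi_cont t0 lu e0; exists d => // s; rewrite /= in_itv/= andbT => s0 sd.
apply: dP => //; apply: (@le_lt_trans _ _ 0%:E); last by rewrite lte_fin.
by apply/normLinf_leP => //; apply: lebesgue_aeW => q _ /=; rewrite subrr normr0.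
Qed.

(** Continuity at time 0 and input 0 gives the bound 1 for short times and small inputs. Homogeneity
    rescales it to inputs of norm at most [C], and [convolution_growth] carries it to [tau]. *)
Lemma input_map_bounded (C tau : R) : 0 < C -> exists2 K : R, 0 <= K &
  forall u, Linf u -> (normLinf Rplus u <= C%:E)%E ->
    forall t, 0 <= t <= tau -> `|Phi t u| <= K.
Proof.
move=> C0; have [d d0 dP] := Phi_cont (lexx 0) (Linf_cst0 U) ltr01.
have Phi0 : Phi 0 (fun=> 0) = 0.
  apply: (is_convolutionX_unique (Phi_conv (lexx 0) (Linf_cst0 U))).
  by rewrite linear0; exact: is_convolution0.
have d20 : 0 < d / 2 by rewrite divr_gt0.
(* Scaling by [k] brings the norm from [C] down to [d / 2], strictly inside the radius [d]. *)
pose k := d / 2 / C; have k0 : 0 < k by rewrite divr_gt0.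
have small u h : Linf u -> (normLinf Rplus u <= C%:E)%E -> 0 <= h <= d / 2 ->
    `|Phi h u| <= k^-1.
  move=> lu uC /andP[h0 hd].
  have lku := LinfZ k lu.
  (* Homogeneity of [Phi h] is deduced from uniqueness of convolutions. *)
  have <- : k^-1 *: Phi h (fun s => k *: u s) = Phi h u.
    rewrite (is_convolutionX_unique (Phi_conv h0 lku) (x' := k *: Phi h u)).
      by rewrite scalerA mulVf ?scale1r// gt_eqF.
    by rewrite linearZ; exact/is_convolutionZ/Phi_conv.
  rewrite normrZ gtr0_norm ?invr_gt0// -[leRHS]mulr1 ler_wpM2l ?invr_ge0 ?(ltW k0)//.
  have := dP h (fun s => k *: u s) h0 lku; rewrite Phi0 !subr0 ger0_norm// => Ph.
  apply/ltW/Ph; first lra.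
  apply: (@le_lt_trans _ _ (d / 2)%:E); last by rewrite lte_fin; lra.
  apply/normLinf_leP; first lra.
  move/(normLinf_leP _ _ (ltW C0)) : uC; apply: lebesgue_aeS => s us sR /=.
  rewrite subr0 normrZ gtr0_norm//; apply: (@le_trans _ _ (k * C)).
    by rewrite ler_wpM2l ?(ltW k0)// us.
  by rewrite /k divfK// gt_eqF.
have [lam lam0 growth] := convolution_growth B d20.
exists (2 * k^-1 * expR (lam * tau)).
  by rewrite !mulr_ge0 ?expR_ge0// invr_ge0 ltW.
move=> u lu uC t /andP[t0 ttau].
have : `|Phi t u| <= 2 * k^-1 * expR (lam * t).
  apply: (growth u (Phi^~ u) tau) => [s /andP[s0 _]|r h r0 /andP[h0 hd] rh|]; last by rewrite t0.
    exact: Phi_conv.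
  have lur := Linf_translation r0 lu.
  exists (Phi h (fun s => u (s + r))); first exact: Phi_conv.
  apply: (@le_trans _ _ (k^-1 * 1)).
    rewrite mulr1; apply: small => //; last by rewrite h0.
    apply/normLinf_leP; first exact: ltW.
    move/(normLinf_leP _ _ (ltW C0)) : uC => uC.
    apply: lebesgue_aeS (ae_translation r uC) => s + sR; apply.
    by move: sR; rewrite /Rplus /= !in_itv/= !andbT => sR; exact: addr_ge0.
  rewrite ler_wpM2l ?invr_ge0 ?(ltW k0)// -expR0 ler_expR.
  by rewrite mulr_ge0// addr_ge0.
move=> /le_trans; apply; rewrite ler_wpM2l ?mulr_ge0 ?invr_ge0 ?(ltW k0)//.
by rewrite ler_expR ler_wpM2l.
Qed.

End input_map.

End convolutions_in_X.

(** * Mild solutions *)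

Lemma within_continuousD (R : realType) (X : normedModType R) (D : set R) (x y : R -> X) :
  {within D, continuous x} -> {within D, continuous y} ->
  {within D, continuous (fun s => x s + y s)}.
Proof.
move=> /within_continuousP cx /within_continuousP cy; apply/within_continuousP.
move=> t e Dt e0; have e20 : 0 < e / 2 by rewrite divr_gt0.
have [d d0 dP] := cx t _ Dt e20; have [d' d'0 d'P] := cy t _ Dt e20.
exists (Num.min d d') => [|s Ds]; first by rewrite lt_min d0.
rewrite lt_min => /andP[sd sd']; rewrite opprD addrACA.
apply: (le_lt_trans (ler_normD _ _)).
have := dP s Ds sd; have := d'P s Ds sd'; lra.
Qed.

Lemma within_continuous_clamp (R : realType) (X : normedModType R) (tau : R) (x : R -> X) :
  0 <= tau -> {within `[0, tau], continuous x} ->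
  {within Rplus, continuous (fun s => x (Num.min s tau))}.
Proof.
move=> tau0 /within_continuousP cx; apply/within_continuousP => t e Rt e0.
have clamp s : Rplus s -> `[0, tau]%classic (Num.min s tau).
  by rewrite /Rplus /= !in_itv/= andbT le_min ge_min lexx orbT tau0 => ->.
have [d d0 dP] := cx _ e (clamp t Rt) e0; exists d => // s Rs sd.
apply: dP; first exact: clamp.
apply: le_lt_trans sd; rewrite ler_norml.
have := ler_norm (s - t); have := ler_norm (t - s); rewrite (distrC t s).
by case: (leP s tau) => ?; case: (leP t tau) => ? ? ?; apply/andP; split; lra.
Qed.

(** The tail of a geometric series of ratio 1/2 makes [u] Cauchy and yields the factor 2. *)
Lemma halving_steps_lim (R : realType) (X : completeNormedModType R) (u : nat -> X) (k : R) :
  0 <= k -> (forall n, `|u n.+1 - u n| <= k / 2 ^+ n) ->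
  forall n, `|u n - limn u| <= 2 * k / 2 ^+ n.
Proof.
move=> k0 uk.
have um m n : `|u (n + m)%N - u n| <= 2 * k / 2 ^+ n.
  elim: m n => [|m IHm] n.
    by rewrite addn0 subrr normr0 divr_ge0 ?mulr_ge0// exprn_ge0.
  rewrite -(subrK (u n.+1) (u (n + m.+1)%N)) -addrA addnS -addSn.
  apply: le_trans (ler_normD _ _) _; apply: le_trans (lerD (IHm n.+1) (uk n)) _.
  rewrite exprSr le_eqVlt; apply/orP; left; apply/eqP.
  by field; rewrite gt_eqF ?exprn_gt0.
have ucvg : cvgn u.
  apply: cauchy_cvg; apply: cauchy_exP => e e0.
  have [n ne] : exists n, 2 * k / 2 ^+ n < e.
    apply: contrapT => noe; have : e <= 0.
      apply: (@le_of_halving _ _ _ (2 * k)); first exact: mulr_ge0.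
      by move=> n; rewrite addr0 leNgt; apply/negP => ne; apply: noe; exists n.
    by rewrite leNgt e0.
  exists (u n); exists n => // m /= nm; rewrite -ball_normE /=; apply: le_lt_trans ne.
  by rewrite distrC -(subnKC nm); exact: um.
move=> n; rewrite distrC.
have : `|u m - u n| @[m --> \oo] --> `|limn u - u n|.
  by apply: cvg_norm; apply: cvgB => //; exact: cvg_cst.
move=> /ler_cvg_to/(_ (cvg_cst (2 * k / 2 ^+ n))); apply.
by exists n => // m /= nm; rewrite -(subnKC nm); exact: um.
Qed.

Section semilinear.
Context (R : realType) (X E : completeNormedModType R) (U V : normedModType R).
Context (T : R -> {linear X -> X}) (T1 : R -> {linear E -> E}) (j : {linear X -> E}).
Hypotheses (hT : C0_semigroup T) (hT1 : C0_semigroup T1).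
Hypothesis T1j : forall t x, 0 <= t -> T1 t (j x) = j (T t x).
Hypothesis j_inj : injective j.
Context (B : {linear U -> E}) (B2 : {linear V -> E}) (f : X -> U -> V).
Hypothesis hB2 : zero_class_admissible j T1 B2.
Context (Phi : R -> (R -> U) -> X).
Hypothesis Phi_conv : forall (t : R) u, 0 <= t -> Linf u ->
  is_convolution T1 B t u (j (Phi t u)).
Hypothesis Phi_cont : forall (t : R) (u : R -> U), 0 <= t -> Linf u -> forall e : R, 0 < e ->
  exists2 delta : R, 0 < delta &
    forall (t' : R) (u' : R -> U), 0 <= t' -> Linf u' ->
      `|t' - t| < delta -> (normLinf Rplus (u' \- u)%R < delta%:E)%E ->
      `|Phi t' u' - Phi t u| < e.
Hypothesis f_Linf : forall (u : R -> U) (x : R -> X), Linf u ->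
  {within Rplus, continuous x} -> Linf_loc (fun s => f (x s) (u s)).
Context (L : R).
Hypothesis L0 : 0 < L.
Hypothesis f_lip : forall (x y : X) (v : U), `|f y v - f x v| <= L * `|y - x|.
Local Notation leb := (@lebesgue_measure R).

(* [xt] extends [x] continuously beyond [tau], so that the hypothesis on
   [f (x s) (u s)], which concerns the whole half-line, applies. *)
Lemma mild_solution_repr x0 u tau x : 0 <= tau -> Linf u ->
  mild_solution j T1 T B B2 f x0 u tau x ->
  exists (xt Z : R -> X), [/\ {within Rplus, continuous xt},
    forall s, 0 <= s <= tau -> xt s = x s,
    forall s, 0 <= s <= tau -> is_convolution T1 B2 s (fun r => f (xt r) (u r)) (j (Z s))
  & forall s, 0 <= s <= tau -> xt s = T s x0 + Z s + Phi s u].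
Proof.
move=> tau0 lu [cx mx]; pose xt s := x (Num.min s tau).
have cxt : {within Rplus, continuous xt} := within_continuous_clamp tau0 cx.
have xtx s : 0 <= s <= tau -> xt s = x s by move=> /andP[_ ?]; rewrite /xt min_l.
have lv := f_Linf lu cxt.
have /choice[Z cZ] s : exists z, 0 <= s <= tau ->
    is_convolution T1 B2 s (fun r => f (xt r) (u r)) (j z).
  have [/andP[s0 stau]|] := boolP (0 <= s <= tau); last by exists 0.
  by have [z cz] := zero_class_convolution hB2 s0 lv; exists z.
exists xt, Z; split => // s stau; apply: j_inj.
rewrite xtx//; have [I2 [I [cI2 cI ->]]] := mx s stau; rewrite !linearD.
have s0 : 0 <= s by case/andP : stau.
rewrite (is_convolution_unique cI (Phi_conv s0 lu)).
congr (_ + _ + _); apply: is_convolution_unique (cZ s stau).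
apply: eq_is_convolution cI2 => r /andP[r0 rs]; rewrite xtx// r0.
by case/andP : stau => _; exact: le_trans.
Qed.

(** The choice [e = (4 * L)^-1] gives [2 * e * (L * K) = K / 2]. Since [lam] precedes [v], [tau] and
    [K], one weight serves all intervals and inputs. *)
Lemma semilinear_contraction : exists2 lam : R, 0 <= lam &
  forall (v : R -> V) (Z : R -> X) (tau K : R), Linf_loc v ->
    (forall s, 0 <= s <= tau -> is_convolution T1 B2 s v (j (Z s))) -> 0 <= K ->
    {ae leb, forall s, 0 <= s <= tau -> `|v s| <= L * K * expR (lam * s)} ->
    forall s, 0 <= s <= tau -> `|Z s| <= K / 2 * expR (lam * s).
Proof.
have e0 : 0 < (4 * L)^-1 by rewrite invr_gt0 mulr_gt0.
have [lam lam0 growth] := zero_class_growth hT hT1 T1j j_inj hB2 e0.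
exists lam => // v Z tau K lv cZ K0 vK s stau.
apply: le_trans (growth v Z tau (L * K) lv cZ _ vK s stau) _.
  by rewrite mulr_ge0// ltW.
rewrite ler_wpM2r ?expR_ge0// le_eqVlt; apply/orP; left; apply/eqP.
by field; rewrite gt_eqF.
Qed.

(** * Uniqueness, a priori bound and existence for a fixed weight *)

Section fixed_rate.
Variable lam : R.
Hypothesis contraction_lam :
  forall (v : R -> V) (Z : R -> X) (tau K : R), Linf_loc v ->
    (forall s, 0 <= s <= tau -> is_convolution T1 B2 s v (j (Z s))) -> 0 <= K ->
    {ae leb, forall s, 0 <= s <= tau -> `|v s| <= L * K * expR (lam * s)} ->
    forall s, 0 <= s <= tau -> `|Z s| <= K / 2 * expR (lam * s).

Lemma convolution_contraction u x y Zx Zy tau K : Linf u ->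
  {within Rplus, continuous x} -> {within Rplus, continuous y} ->
  (forall s, 0 <= s <= tau ->
     is_convolution T1 B2 s (fun r => f (x r) (u r)) (j (Zx s))) ->
  (forall s, 0 <= s <= tau ->
     is_convolution T1 B2 s (fun r => f (y r) (u r)) (j (Zy s))) ->
  0 <= K -> (forall s, 0 <= s <= tau -> `|x s - y s| <= K * expR (lam * s)) ->
  forall s, 0 <= s <= tau -> `|Zx s - Zy s| <= K / 2 * expR (lam * s).
Proof.
move=> lu cx cy cZx cZy K0 xyK.
apply: (contraction_lam (v := fun s => f (x s) (u s) - f (y s) (u s))) => //.
- by apply: Linf_locB; exact: f_Linf.
- by move=> s stau; rewrite linearB; apply: is_convolutionB; [exact: cZx|exact: cZy].
apply: lebesgue_aeW => s stau; apply: le_trans (f_lip _ _ _) _.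
by rewrite -mulrA ler_wpM2l ?(ltW L0)// xyK.
Qed.

Hypothesis lam0 : 0 <= lam.

Let weight_ge1 s : 0 <= s -> 1 <= expR (lam * s).
Proof. by move=> s0; rewrite -expR0 ler_expR mulr_ge0. Qed.

Lemma Rplus_continuous_bounded (x : R -> X) (tau : R) : 0 <= tau ->
  {within Rplus, continuous x} ->
  exists2 K : R, 0 <= K & forall s, 0 <= s <= tau -> `|x s| <= K * expR (lam * s).
Proof.
move=> tau0 cx; have [|K K0 xK] := bounded_on_segment tau0 (x := x).
  by apply: continuous_subspaceW cx => s; rewrite /Rplus /= !in_itv/= andbT => /andP[].
exists K => // s /andP[s0 stau]; apply: (@le_trans _ _ (K * 1)).
  by rewrite mulr1 xK// s0.
by rewrite ler_wpM2l// weight_ge1.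
Qed.

(** The terms with [T] and [Phi] cancel in the difference, so each pass through the equation halves
    the weighted distance, which is finite at the start by continuity on a segment. *)
Lemma mild_solution_unique x0 u tau x y : 0 <= tau -> Linf u ->
  mild_solution j T1 T B B2 f x0 u tau x -> mild_solution j T1 T B B2 f x0 u tau y ->
  forall s, 0 <= s <= tau -> x s = y s.
Proof.
move=> tau0 lu mx my.
have [xt [Zx [cxt xtx cZx xE]]] := mild_solution_repr tau0 lu mx.
have [yt [Zy [cyt yty cZy yE]]] := mild_solution_repr tau0 lu my.
have [Kx Kx0 xK] := Rplus_continuous_bounded tau0 cxt.
have [Ky Ky0 yK] := Rplus_continuous_bounded tau0 cyt.
have xyn n s : 0 <= s <= tau -> `|xt s - yt s| <= (Kx + Ky) / 2 ^+ n * expR (lam * s).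
  elim: n s => [|n IHn] s stau.
    rewrite expr0 divr1 mulrDl; apply: le_trans (ler_normB _ _) _.
    by apply: lerD; [exact: xK|exact: yK].
  rewrite xE// yE// (_ : _ - _ = Zx s - Zy s); last first.
    by rewrite opprD addrACA subrr addr0 opprD addrACA subrr add0r.
  have Kn : 0 <= (Kx + Ky) / 2 ^+ n by rewrite divr_ge0 ?addr_ge0// exprn_ge0.
  have := convolution_contraction lu cxt cyt cZx cZy Kn IHn stau.
  by rewrite exprSr invfM mulrA.
move=> s stau; rewrite -xtx// -yty//; apply/eqP; rewrite -subr_eq0 -normr_le0.
apply: (@le_of_halving _ _ _ ((Kx + Ky) * expR (lam * s))).
  by rewrite mulr_ge0 ?addr_ge0// expR_ge0.
by move=> n; rewrite addr0 mulrAC; exact: xyn.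
Qed.

(** One pass through the equation turns a weighted bound [a] into [b + (a + D / L) / 2], with fixed
    point [2 * b + D / L]. The excess [K], which depends on the solution, is halved at each pass. *)
Lemma mild_solution_bound (x0 : X) u tau x (b D : R) : 0 <= tau -> Linf u -> 0 <= D ->
  {ae leb, forall s, 0 <= s -> `|f 0 (u s)| <= D} ->
  (forall s, 0 <= s <= tau -> `|T s x0 + Phi s u| <= b) ->
  mild_solution j T1 T B B2 f x0 u tau x ->
  forall s, 0 <= s <= tau -> `|x s| <= (2 * b + D / L) * expR (lam * s).
Proof.
move=> tau0 lu D0 fD Tb mx.
have b0 : 0 <= b by apply: le_trans (normr_ge0 _) (Tb 0 _); rewrite lexx.
have [xt [Z [cxt xtx cZ xE]]] := mild_solution_repr tau0 lu mx.
have [K K0 xK] := Rplus_continuous_bounded tau0 cxt.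
pose c := 2 * b + D / L; have c0 : 0 <= c.
  by rewrite addr_ge0 ?mulr_ge0// invr_ge0 ltW.
have xn n s : 0 <= s <= tau -> `|xt s| <= (K / 2 ^+ n + c) * expR (lam * s).
  elim: n s => [|n IHn] s stau.
    rewrite expr0 divr1; apply: le_trans (xK s stau) _.
    by rewrite ler_wpM2r ?expR_ge0// lerDl.
  have Kn : 0 <= K / 2 ^+ n by rewrite divr_ge0// exprn_ge0.
  have Zs : `|Z s| <= (K / 2 ^+ n + c + D / L) / 2 * expR (lam * s).
    apply: (contraction_lam (f_Linf lu cxt) cZ) stau.
      by apply: addr_ge0; [exact: addr_ge0|rewrite divr_ge0// ltW].
    apply: lebesgue_aeS fD => r fr rtau; have r0 : 0 <= r by case/andP : rtau.
    rewrite -(subrK (f 0 (u r)) (f (xt r) (u r))).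
    apply: le_trans (ler_normD _ _) _.
    apply: (@le_trans _ _ (L * ((K / 2 ^+ n + c) * expR (lam * r)) + D * expR (lam * r))).
      apply: lerD.
        apply: le_trans (f_lip _ _ _) _; rewrite subr0.
        by rewrite ler_wpM2l ?(ltW L0)// IHn.
      by apply: le_trans (fr r0) _; rewrite ler_peMr// weight_ge1.
    rewrite le_eqVlt; apply/orP; left; apply/eqP.
    by field; rewrite !gt_eqF ?exprn_gt0.
  rewrite xE// addrAC; apply: le_trans (ler_normD _ _) _.
  apply: (@le_trans _ _ (b * expR (lam * s) + (K / 2 ^+ n + c + D / L) / 2 * expR (lam * s))).
    apply: lerD Zs; apply: le_trans (Tb s stau) _.
    by rewrite ler_peMr// weight_ge1//; case/andP : stau.
  rewrite -mulrDl ler_wpM2r ?expR_ge0// le_eqVlt; apply/orP; left; apply/eqP.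
  by rewrite /c exprSr; field; rewrite !gt_eqF ?exprn_gt0.
move=> s stau; rewrite -xtx//.
apply: (@le_of_halving _ _ _ (K * expR (lam * s))); first by rewrite mulr_ge0 ?expR_ge0.
by move=> n; rewrite mulrAC -mulrDl; exact: xn.
Qed.

(** The constants depend on [tau] but the iterates do not, so they converge on the whole half-line,
    uniformly on each segment. *)
Lemma mild_solution_exists x0 u : Linf u ->
  exists x, forall tau, 0 <= tau -> mild_solution j T1 T B B2 f x0 u tau x.
Proof.
move=> lu.
(* [S] is total, with a specification guarded by continuity, so that [step] can be iterated on plain
   functions. *)
have /choice[S S_conv] (x : R -> X) : exists Z : R -> X, {within Rplus, continuous x} ->
    forall s, 0 <= s -> is_convolution T1 B2 s (fun r => f (x r) (u r)) (j (Z s)).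
  have [cx|] := pselect {within Rplus, continuous x}; last by exists (cst 0).
  have /choice[Z cZ] s : exists z, 0 <= s ->
      is_convolution T1 B2 s (fun r => f (x r) (u r)) (j z).
    have [s0|] := boolP (0 <= s); last by exists 0.
    by have [z cz] := zero_class_convolution hB2 s0 (f_Linf lu cx); exists z.
  by exists Z.
pose step x s := T s x0 + S x s + Phi s u.
have step_cont x : {within Rplus, continuous x} -> {within Rplus, continuous (step x)}.
  move=> cx; apply: within_continuousD; last exact: (input_map_continuous Phi_cont).
  apply: within_continuousD.
    apply/within_continuousP => t e; rewrite /Rplus /= in_itv/= andbT => t0 e0.
    have [d d0 dP] := semigroup_continuous hT x0 t0 e0; exists d => // s.
    by rewrite /= in_itv/= andbT; exact: dP.
  exact: (zero_class_continuous hT hT1 T1j j_inj hB2 (f_Linf lu cx) (S_conv x cx)).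
have step_contr x y tau K : {within Rplus, continuous x} -> {within Rplus, continuous y} ->
    0 <= K -> (forall s, 0 <= s <= tau -> `|x s - y s| <= K * expR (lam * s)) ->
    forall s, 0 <= s <= tau -> `|step x s - step y s| <= K / 2 * expR (lam * s).
  move=> cx cy K0 xyK s stau; rewrite (_ : _ - _ = S x s - S y s); last first.
    by rewrite opprD addrACA subrr addr0 opprD addrACA subrr add0r.
  apply: (convolution_contraction lu cx cy) xyK _ stau => // r /andP[r0 _];
    exact: S_conv.
pose x_ n := iter n step (fun=> 0).
have cx_ n : {within Rplus, continuous (x_ n)}.
  elim: n => [|n IHn]; last exact: step_cont.
  by apply/within_continuousP => t e Rt e0; exists 1 => // s _ _; rewrite subrr normr0.
have diff tau : 0 <= tau -> exists2 K : R, 0 <= K & forall n s, 0 <= s <= tau ->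
    `|x_ n.+1 s - x_ n s| <= K / 2 ^+ n * expR (lam * s).
  move=> tau0; have [K K0 xK] := Rplus_continuous_bounded tau0 (cx_ 1%N).
  exists K => // n; elim: n => [|n IHn] s stau.
    by rewrite expr0 divr1 subr0; exact: xK.
  have Kn : 0 <= K / 2 ^+ n by rewrite divr_ge0// exprn_ge0.
  have := step_contr _ _ _ _ (cx_ n.+1) (cx_ n) Kn IHn s stau.
  by rewrite exprSr invfM mulrA.
pose x s := limn (x_^~ s).
have xlim tau : 0 <= tau -> exists2 K : R, 0 <= K & forall n s, 0 <= s <= tau ->
    `|x_ n s - x s| <= K / 2 ^+ n * expR (lam * s).
  move=> tau0; have [K K0 xK] := diff tau tau0; exists (2 * K) => [|n s stau].
    exact: mulr_ge0.
  rewrite mulrAC -[2 * K * _]mulrA; apply: halving_steps_lim => [|m].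
    by rewrite mulr_ge0// expR_ge0.
  by rewrite mulrAC; exact: xK.
have cx : {within Rplus, continuous x}.
  apply/within_continuousP => t e Rt e0.
  have t0 : 0 <= t by move: Rt; rewrite /Rplus /= in_itv/= andbT.
  have [K K0 xK] := xlim (t + 1) (addr_ge0 t0 ler01).
  have [n ne] : exists n, K * expR (lam * (t + 1)) / 2 ^+ n < e / 3.
    apply: contrapT => noe; have : e / 3 <= 0.
      apply: (@le_of_halving _ _ _ (K * expR (lam * (t + 1)))).
        by rewrite mulr_ge0// expR_ge0.
      by move=> n; rewrite addr0 leNgt; apply/negP => ne; apply: noe; exists n.
    by rewrite leNgt divr_gt0.
  have near_x s : 0 <= s <= t + 1 -> `|x_ n s - x s| < e / 3.
    move=> st; apply: le_lt_trans ne; rewrite mulrAC; apply: le_trans (xK n s st) _.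
    rewrite ler_wpM2l ?divr_ge0// ?exprn_ge0// ler_expR ler_wpM2l//.
    by case/andP : st.
  have e3 : 0 < e / 3 by rewrite divr_gt0.
  have /within_continuousP/(_ t _ Rt e3)[d d0 dP] := cx_ n.
  exists (Num.min d 1) => [|s Rs]; first by rewrite lt_min d0 ltr01.
  rewrite lt_min => /andP[sd]; rewrite ltr_norml => /andP[_ s1].
  have s0 : 0 <= s by move: Rs; rewrite /Rplus /= in_itv/= andbT.
  have st : 0 <= s <= t + 1 by rewrite s0/=; lra.
  have tt : 0 <= t <= t + 1 by rewrite t0/=; lra.
  rewrite (_ : x s - x t = (x_ n s - x_ n t) - (x_ n s - x s) + (x_ n t - x t)); last first.
    by rewrite opprB [x_ n s - x_ n t + _]addrC !addrA !subrK.
  apply: le_lt_trans (ler_normD _ _) _.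
  have := ler_normB (x_ n s - x_ n t) (x_ n s - x s).
  have := near_x s st; have := near_x t tt; have := dP s Rs sd; lra.
(* The iterate [x_ n.+1 = step (x_ n)] is within [K / 2 ^+ n.+1], in the weighted sense, both of [x]
   and, by contraction, of [step x]. *)
have xfix s : 0 <= s -> step x s = x s.
  move=> s0; have ss : 0 <= s <= s by rewrite s0 lexx.
  have [K K0 xK] := xlim s s0.
  apply/eqP; rewrite -subr_eq0 -normr_le0.
  apply: (@le_of_halving _ _ _ (K * expR (lam * s))).
    by rewrite mulr_ge0// expR_ge0.
  move=> n; rewrite addr0 mulrAC.
  have Kn : 0 <= K / 2 ^+ n by rewrite divr_ge0// exprn_ge0.
  have le1 := step_contr _ _ _ _ (cx_ n) cx Kn (xK n) s ss.
  have le2 := xK n.+1 s ss.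
  rewrite (_ : step x s - x s = (x_ n.+1 s - x s) - (step (x_ n) s - step x s)); last first.
    by rewrite -[x_ n.+1 s]/(step (x_ n) s) opprB [RHS]addrC addrA subrK.
  apply: le_trans (ler_normB _ _) _; apply: le_trans (lerD le2 le1) _.
  rewrite exprSr le_eqVlt; apply/orP; left; apply/eqP.
  by field; rewrite gt_eqF ?exprn_gt0.
exists x => tau tau0; split.
  by apply: continuous_subspaceW cx => s; rewrite /Rplus /= !in_itv/= andbT => /andP[].
move=> t /andP[t0 _]; exists (j (S x t)), (j (Phi t u)); split.
- exact: S_conv.
- exact: Phi_conv.
by rewrite -xfix// /step !linearD.
Qed.

End fixed_rate.

End semilinear.

(** * Forward completeness and bounded reachability sets *)

Unset Implicit Arguments.
Set Strict Implicit.
Set Printing Implicit Defensive.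

Theorem proposition3p20 (R : realType) (X U V : completeNormedModType R)
  (T : R -> {linear X -> X}) (DA : set X) (A : X -> X)
  (hT : C0_semigroup T) (hA : generator T DA A)
  (a : R) (Ra : {linear X -> X}) (hRa : is_resolvent DA A a Ra)
  (Xm1 : completeNormedModType R) (j : {linear X -> Xm1})
  (hXm1 : is_extrapolation Ra j)
  (Tm1 : R -> {linear Xm1 -> Xm1}) (hTm1 : C0_semigroup Tm1)
  (hTm1T : forall t x, 0 <= t -> Tm1 t (j x) = j (T t x))
  (B : {linear U -> Xm1}) (hB : continuous B)
  (B2 : {linear V -> Xm1}) (hB2 : continuous B2)
  (f : X -> U -> V)
  (ha : admissible j Tm1 B)
  (ha' : continuous_input_map j Tm1 B)
  (hb : zero_class_admissible j Tm1 B2)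
  (hb' : forall (u : R -> U) (x : R -> X), Linf u ->
     {within Rplus, continuous x} -> Linf_loc (fun s => f (x s) (u s)))
  (hc : forall C : R, 0 < C -> exists2 L : R, 0 < L &
     forall (x y : X) (v : U), `|x| < C -> `|y| < C -> `|v| < C ->
       `|f y v - f x v| <= L * `|y - x|)
  (hc' : forall x : X, continuous (f x))
  (hc'' : exists (sigma : R -> R) (c : R), [/\ K_infinity sigma, 0 < c &
     forall v : U, `|f 0 v| <= sigma `|v| + c])
  (hd : exists2 L : R, 0 < L & forall (x y : X) (v : U),
     `|f y v - f x v| <= L * `|y - x|) :
  forward_complete j Tm1 T B B2 f /\
  bounded_reachability_sets j Tm1 T B B2 f.
Proof.
have j_inj : injective j := extrapolation_inj hA hRa hXm1.
have [Phi Phi_conv Phi_cont] := ha'.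
have [L L0 f_lip] := hd.
have [lam lam0 contr] := semilinear_contraction hT hTm1 hTm1T j_inj hb L0.
have maximal x0 u : Linf u ->
    t_max j Tm1 T B B2 f x0 u = +oo%E /\ forall tau : R, 0 < tau ->
      mild_solution j Tm1 T B B2 f x0 u tau (the_maximal_mild_solution j Tm1 T B B2 f x0 u).2.
  move=> lu.
  have [y my] := mild_solution_exists hT hTm1 hTm1T j_inj hb Phi_conv Phi_cont hb'
    L0 f_lip contr lam0 x0 lu.
  have ex : exists p, maximal_mild_solution j Tm1 T B B2 f x0 u p.
    (* No real [tau] is above [+oo], so the global solution is maximal and [xget] does not return
       its default. *)
    exists (+oo%E, y); split => //= [tau tau0 _|[tau [z []]]//].
    exact/my/ltW.
  have := xgetPex (0%E, cst 0) ex.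
  rewrite /t_max -/(the_maximal_mild_solution j Tm1 T B B2 f x0 u).
  case: (the_maximal_mild_solution _ _ _ _ _ _ _ _) => -[r| |] x [/= t0 mx nx].
  (* A finite lifetime [r] contradicts maximality: [y] is mild on the closed interval up to [r], and
     it agrees with [x] at each [t < r] by uniqueness up to the midpoint of [t] and [r]. *)
  - exfalso; apply: nx; exists r, y; split => // [|t t_ge0].
      by apply: my; move: t0; rewrite lte_fin => /ltW.
    rewrite !lte_fin in t0 * => tr; pose tau := (t + r) / 2.
    have tau0 : 0 < tau by rewrite /tau; lra.
    have mxtau : mild_solution j Tm1 T B B2 f x0 u tau x.
      by apply: mx => //; rewrite lte_fin /tau; lra.
    apply: (mild_solution_unique j_inj hb Phi_conv hb' L0 f_lip contr lam0
      (ltW tau0) lu (my _ (ltW tau0)) mxtau).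
    by rewrite t_ge0/= /tau; lra.
  - by split => // tau tau0; apply: mx => //; exact: ltry.
  - by rewrite ltNge leNye in t0.
split; first by move=> x0 u lu; have [] := maximal x0 u lu.
move=> C tau C0 tau0.
have [M M1 TM] := semigroup_bounded hT tau.
have M0 : 0 <= M := le_trans ler01 M1.
have [K K0 PhiK] := input_map_bounded hT hTm1 hTm1T j_inj Phi_conv Phi_cont tau C0.
have [sigma [c [[_ sigma_incr _ sigma0] c0 f0]]] := hc''.
have D0 : 0 <= sigma C + c.
  by rewrite addr_ge0 ?(ltW c0)// -sigma0; apply/ltW/sigma_incr.
(* The a priori bound with [b = M * C + K] and [D = sigma C + c], taken at the final time; it
   involves neither [x0] nor [u]. *)
pose W := (2 * (M * C + K) + (sigma C + c) / L) * expR (lam * tau).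
apply: (@le_lt_trans _ _ W%:E); last exact: ltry.
apply: ge_ereal_sup => _ [t [x0 [u [/andP[t0 ttau] x0C lu uC ->]]]].
have [_ /(_ tau tau0) mx] := maximal x0 u lu.
rewrite lee_fin; apply: (@le_trans _ _
  ((2 * (M * C + K) + (sigma C + c) / L) * expR (lam * t))); last first.
  rewrite ler_wpM2l ?ler_expR ?ler_wpM2l//.
  by apply: addr_ge0; [rewrite mulr_ge0// addr_ge0// mulr_ge0// ltW|rewrite divr_ge0// ltW].
apply: (mild_solution_bound j_inj hb Phi_conv hb' L0 f_lip contr lam0 (ltW tau0) lu D0 _ _ mx).
- move/(normLinf_leP _ _ (ltW C0)) : uC; apply: lebesgue_aeS => s + s0.
  have sR : Rplus s by rewrite /Rplus /= in_itv/= s0.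
  move=> /(_ sR) uC; apply: le_trans (f0 _) _; rewrite lerD2r.
  move: uC; rewrite le_eqVlt => /orP[/eqP->//|uC]; apply/ltW/sigma_incr => //.
- move=> s stau; apply: le_trans (ler_normD _ _) _; apply: lerD; last exact: PhiK.
  by apply: le_trans (TM s x0 stau) _; rewrite ler_wpM2l.
by rewrite t0.
Qed.
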